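(* Let $\mathcal{E}_{\text{init}} = \{q(x),|x\rangle\}$ be a set of orthonormal initial states $|x\rangle$ of $N_A+N_B$ qubits with probability distribution $q(x)$, and let $S_c = -\log_2\left(\sum_x q(x)^2\right)$ be the Rényi 2-entropy of $q(x)$. For any integer $k$ with $2 \le k < 2^{(N_A+N_B)/4}$, the root-mean-square distance $\Delta_{\text{rms}}^{(k)}$ (over Haar-random $U$ in the unitary group $\mathcal{U}(2^{N_A+N_B})$) between the $k$-th moments of the projected ensemble $\mathcal{E}$ and the Haar ensemble on the $N_A$ qubits of $A$ approaches $$\left(\Delta_{\text{rms}}^{(k)}\right)^2 = \frac{1}{k!\, 2^{S_c+N_B-kN_A}}$$ as $N_A$ and $N_B \to \infty$.
   Context: Setting: a system of $N=N_A+N_B$ qubits is split into $A$ ($N_A$ qubits, Hilbert space dimension $d_A=2^{N_A}$) and $B$ ($N_B$ qubits, dimension $d_B=2^{N_B}$). $\{|z\rangle_B\}_{z\in\{0,1\}^{N_B}}$ is the computational basis of $B$. Given a unitary $U$ on $AB$, orthonormal initial states $|x\rangle$ of $AB$ and a probability distribution $q(x)$, put $p_x(z)=\left\|(I_A\otimes\langle z|_B)U|x\rangle\right\|^2$ and let $|\psi_x(z)\rangle = (I_A\otimes\langle z|_B)U|x\rangle/\sqrt{p_x(z)}$ be the normalized post-measurement state on $A$ (terms with $p_x(z)=0$ are omitted). The (classically-enhanced) projected ensemble is $\mathcal{E}=\{q(x)p_x(z);|\psi_x(z)\rangle\}_{x,z}$, with $k$-th moment $$\rho^{(k)}=\sum_{x,z}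 q(x)p_x(z)\,(|\psi_x(z)\rangle\langle\psi_x(z)|)^{\otimes k}.$$ $\rho^{(k)}_{\text{Haar}}=\int d\psi\,(|\psi\rangle\langle\psi|)^{\otimes k}$ is the $k$-th moment of the Haar (unitarily invariant) probability measure on pure states of $A$; it equals the orthogonal projector onto the symmetric subspace of $(\mathbb{C}^{d_A})^{\otimes k}$ divided by its dimension $\binom{d_A+k-1}{k}$. The normalized Hilbert–Schmidt distance is $\Delta^{(k)}=\|\rho^{(k)}-\rho^{(k)}_{\text{Haar}}\|_2/\|\rho^{(k)}_{\text{Haar}}\|_2$, where $\|\cdot\|_2$ is the Hilbert–Schmidt norm; it is a function of $U$. The root-mean-square distance is $\Delta_{\text{rms}}^{(k)}=\sqrt{\mathbb{E}_{U}\left[(\Delta^{(k)})^2\right]}$, the expectation being over $U$ drawn from the Haar measure on $\mathcal{U}(2^{N_A+N_B})$. *)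

(* Defs.v *)
From HB Require Import structures.
From mathcomp Require Import all_boot all_order all_algebra.
From mathcomp Require Import complex mxtens.
From mathcomp Require Import all_classical all_reals all_analysis.

Set Implicit Arguments.
Unset Strict Implicit.
Unset Printing Implicit Defensive.

Import Order.TTheory GRing.Theory Num.Theory.
Import numFieldNormedType.Exports.

Local Open Scope classical_set_scope.
Local Open Scope ring_scope.
Local Open Scope complex_scope.
Local Open Scope sesquilinear_scope.

Notation borel T := (g_sigma_algebraType (@open T)).

(* [R[i]^o] is convertible to [R[i]]; it is the alias that carries the topology
   of the modulus, from which matrices and their [set_type] subtypes inherit. *)
Definition unitary_set (R : realType) (n : nat) : set 'M[R[i]^o]_n :=
  [set U : 'M[R[i]^o]_n | (U : 'M[R[i]]_n) \is unitarymx].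

Definition unitary_group (R : realType) (n : nat) : Type :=
  set_type (@unitary_set R n).

Lemma unitary_set1 (R : realType) (n : nat) :
  (1%:M : 'M[R[i]]_n) \in @unitary_set R n.
Proof. by apply/mem_set/unitarymxP; rewrite trmx1 map_mx1 mulmx1. Qed.

HB.instance Definition _ (R : realType) (n : nat) :=
  Topological.on (unitary_group R n).
HB.instance Definition _ (R : realType) (n : nat) :=
  isPointed.Build (unitary_group R n)
    (@exist _ (fun U => U \in @unitary_set R n) _ (unitary_set1 R n)).

Definition unitary_mx (R : realType) (n : nat) (U : unitary_group R n) :
  'M[R[i]]_n := set_val U.

Lemma unitary_mxP (R : realType) (n : nat) (U : unitary_group R n) :
  unitary_mx U \is unitarymx.
Proof. exact: (set_mem (svalP U)). Qed.

Lemma unitary_set_mul (R : realType) (n : nat) (V W : unitary_group R n) :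
  unitary_mx V *m unitary_mx W \in @unitary_set R n.
Proof. by apply/mem_set/mul_unitarymx; exact: unitary_mxP. Qed.

Definition unitary_mul (R : realType) (n : nat) (V W : unitary_group R n) :
  unitary_group R n :=
  @exist _ (fun U => U \in @unitary_set R n) _ (unitary_set_mul V W).

Definition is_haar (R : realType) (n : nat)
    (mu : probability (borel (unitary_group R n)) R) : Prop :=
  forall (V : unitary_group R n) (A : set (borel (unitary_group R n))),
    measurable A ->
    mu [set U | A (unitary_mul V U)] = mu A /\
    mu [set U | A (unitary_mul U V)] = mu A.

(* Pure states of [N] qubits are represented by unit vectors; the phase is
   immaterial, as only [ketbra] of a state is ever used. *)
Definition unit_vectors (R : realType) (N : nat) : set 'cV[R[i]^o]_(2 ^ N) :=
  [set v : 'cV[R[i]^o]_(2 ^ N) |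
    (v : 'cV[R[i]]_(2 ^ N))^t* *m (v : 'cV[R[i]]_(2 ^ N)) = 1%:M].

Definition pure_state (R : realType) (N : nat) : Type :=
  set_type (@unit_vectors R N).

Definition state_vec (R : realType) (N : nat) (v : pure_state R N) :
  'cV[R[i]]_(2 ^ N) := set_val v.

Lemma expn2_gt0 (N : nat) : (0 < 2 ^ N)%N.
Proof. by rewrite expn_gt0. Qed.

Lemma unit_vectors_delta (R : realType) (N : nat) :
  (delta_mx (Ordinal (expn2_gt0 N)) 0 : 'cV[R[i]]_(2 ^ N))
    \in @unit_vectors R N.
Proof.
apply/mem_set; rewrite /unit_vectors /=.
rewrite trmx_delta map_delta_mx mul_delta_mx.
by apply/matrixP => i j; rewrite !ord1 !mxE.
Qed.

HB.instance Definition _ (R : realType) (N : nat) :=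
  Topological.on (pure_state R N).
HB.instance Definition _ (R : realType) (N : nat) :=
  isPointed.Build (pure_state R N)
    (@exist _ (fun v => v \in @unit_vectors R N) _ (unit_vectors_delta R N)).

Lemma unit_vectors_mul (R : realType) (N : nat)
    (V : unitary_group R (2 ^ N)) (v : pure_state R N) :
  unitary_mx V *m state_vec v \in @unit_vectors R N.
Proof.
apply/mem_set; rewrite /unit_vectors /= trmx_mul map_mxM /= mulmxA.
have uV := unitary_mxP V.
rewrite -(mulmxA _ _ (unitary_mx V)) -invmx_unitary// mulVmx ?unitarymx_unit//.
by rewrite mulmx1; exact: (set_mem (svalP v)).
Qed.

Definition rotate (R : realType) (N : nat)
    (V : unitary_group R (2 ^ N)) (v : pure_state R N) : pure_state R N :=
  @exist _ (fun v => v \in @unit_vectors R N) _ (unit_vectors_mul V v).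

Definition is_haar_state (R : realType) (N : nat)
    (nu : probability (borel (pure_state R N)) R) : Prop :=
  forall (V : unitary_group R (2 ^ N)) (A : set (borel (pure_state R N))),
    measurable A -> nu [set v | A (rotate V v)] = nu A.

(* The Hilbert-Schmidt norm; on column vectors, the Euclidean norm. *)
Definition hsnorm (R : realType) (m n : nat) (M : 'M[R[i]]_(m, n)) : R :=
  Num.sqrt (\sum_i \sum_j Normc.normc (M i j) ^+ 2).

Definition ketbra (R : realType) (n : nat) (v : 'cV[R[i]]_n) : 'M[R[i]]_n :=
  v *m v^t*.

Section ProjectedEnsemble.
Variables (R : realType) (NA NB : nat) (X : finType).
Variables (q : X -> R) (phi : X -> 'cV[R[i]]_(2 ^ NA * 2 ^ NB)).

Definition is_distr : Prop := (forall x, 0 <= q x) /\ \sum_x q x = 1.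

Definition orthonormal_kets : Prop :=
  forall x y, (phi x)^t* *m phi y = ((x == y)%:R)%:M.

Definition renyi2 : R := - (ln (\sum_x q x ^+ 2) / ln 2).

(* [(I_A (x) <z|_B) v]. The basis vector [|a>_A |z>_B] has index
   [mxtens_index (a, z)], as for the Kronecker product [_ *t _]; the bit string
   [z] is read as a number below [2 ^ NB]. *)
Definition project (z : 'I_(2 ^ NB)) (v : 'cV[R[i]]_(2 ^ NA * 2 ^ NB)) :
  'cV[R[i]]_(2 ^ NA) := \col_a v (mxtens_index (a, z)) 0.

Variable k : nat.

Section FixedUnitary.
Variable U : unitary_group R (2 ^ NA * 2 ^ NB).

Definition unnorm_state (x : X) (z : 'I_(2 ^ NB)) : 'cV[R[i]]_(2 ^ NA) :=
  project z (unitary_mx U *m phi x).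

Definition born (x : X) (z : 'I_(2 ^ NB)) : R := hsnorm (unnorm_state x z) ^+ 2.

Definition post_state (x : X) (z : 'I_(2 ^ NB)) : 'cV[R[i]]_(2 ^ NA) :=
  ((Num.sqrt (born x z))^-1)%:C *: unnorm_state x z.

Definition moment : 'M[R[i]]_((2 ^ NA) ^ k) :=
  \sum_x \sum_(z | born x z != 0)
    (q x * born x z)%:C *: ntensmx (ketbra (post_state x z)) k.

End FixedUnitary.

Variable nu : probability (borel (pure_state R NA)) R.

Definition haar_moment : 'M[R[i]]_((2 ^ NA) ^ k) :=
  \matrix_(i, j)
    ((\int[nu]_v complex.Re (ntensmx (ketbra (state_vec v)) k i j))
     +i* (\int[nu]_v complex.Im (ntensmx (ketbra (state_vec v)) k i j))).

Definition hs_distance (U : unitary_group R (2 ^ NA * 2 ^ NB)) : R :=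
  hsnorm (moment U - haar_moment) / hsnorm haar_moment.

Variable mu : probability (borel (unitary_group R (2 ^ NA * 2 ^ NB))) R.

Definition rms_distance : R :=
  Num.sqrt (fine 'E_mu[fun U => (hs_distance U ^+ 2)%R]%E).

End ProjectedEnsemble.

(* Main.v *)
Require Import Defs.
From HB Require Import structures.
From mathcomp Require Import all_boot all_order all_algebra.
From mathcomp Require Import complex mxtens.
From mathcomp Require Import all_classical all_reals all_analysis.
From mathcomp Require Import measurable_realfun.
From mathcomp Require Import ring lra zify.

(** Let [d], [b] be the dimensions of [A], [B], let [D = binom(d + k - 1, k)] and
    let [u_x(z)] be the unnormalized post-measurement state. Integrating
    [|<w, psi>|^(2k)] over Haar states gives [1 / D] for every unit [w], so the
    squared distance is
      [D * sum q(x) q(y) p_x(z) p_y(w) |<psi_x(z), psi_y(w)>|^(2k) - 1].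
    Now average over [U].
    - If [z <> w], a unitary acting on the block [z] only moves [u_x(z)] and not
      [u_y(w)]: the overlap averages to exactly [1 / D], which the [-1] cancels.
    - The terms [z = w], [x = y] are second moments of [p_x(z)] and give the
      announced value.
    - If [z = w], [x <> y], then, given the column [x] of [U], the column [y] is
      uniform in its orthogonal complement; its block [z] is an isotropic vector
      contracted by [sqrt (1 - p_x(z))] in the direction of [u_x(z)]. The
      correlation is thus [O(k / b)] in relative terms and the total is
      [O(k / b^2)], negligible because the purity of [q] is at least
      [1 / (d b)] and [k >= 2].
    Moments of an isotropic vector [xi] come from invariance only: comparing the
    coefficients of [s^2] in [E |<e_i + s e_j, xi>|^(2k) = c (1 + s^2)^k] relates
    mixed moments to [c], and summing over [j] gives a recursion on [k]. *)

Set Implicit Arguments.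
Unset Strict Implicit.
Unset Printing Implicit Defensive.

Import Order.TTheory GRing.Theory Num.Theory.
Import numFieldNormedType.Exports.

Local Open Scope classical_set_scope.
Local Open Scope ring_scope.
Local Open Scope complex_scope.
Local Open Scope sesquilinear_scope.
Local Notation Re := complex.Re.
Local Notation Im := complex.Im.

(** * Bounded measurable functions *)

Section BoundedMeasurable.
Context (d : measure_display) (T : measurableType d) (R : realType).
Implicit Types (f g : T -> R).

(** Translation invariance gives moments against a deterministic test vector only, while both
    arguments of the overlaps to be averaged are random. Two devices replace conditioning. For
    distinct blocks, an auxiliary Haar state [w], weighted by the kernel [D_l |<u, w>|^(2 l)],
    stands in for [u]: by Fubini, [w] is fixed while [U] is integrated, the result does not depend
    on [l], and [l] grows to infinity. For two columns in the same block, the second column is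
    modelled by a column of an independent Haar unitary minus its component along the first. That
    vector has a random length, but the terms are homogeneous of degree two, so only its mean
    squared length [1 - 1 / m] enters, as a constant factor. The subtracted 1 is itself written as
    the same sum with exponent 0, since the Born probabilities add up to 1, so that all
    cancellations happen term by term. Block vectors stay unnormalized and are weighted by their
    squared norms; the overlap is 0 when one of them vanishes, so no exceptional set of unitaries
    has to be removed. *)

Definition bounded_measurable f :=
  measurable_fun setT f /\ exists M, forall x, `|f x| <= M.

Lemma bm_cst (c : R) : bounded_measurable (fun=> c).
Proof. by split; [exact: measurable_cst|exists `|c|]. Qed.

Lemma bmD f g : bounded_measurable f -> bounded_measurable g ->
  bounded_measurable (fun x => f x + g x).
Proof.
move=> [mf [M hM]] [mg [N hN]]; split; first exact: measurable_funD.
exists (M + N) => x; exact: (le_trans (ler_normD _ _) (lerD (hM x) (hN x))).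
Qed.

Lemma bmM f g : bounded_measurable f -> bounded_measurable g ->
  bounded_measurable (fun x => f x * g x).
Proof.
move=> [mf [M hM]] [mg [N hN]]; split; first exact: measurable_funM.
by exists (M * N) => x; rewrite normrM ler_pM.
Qed.

Lemma bmZ c f : bounded_measurable f -> bounded_measurable (fun x => c * f x).
Proof. by move=> bf; apply: bmM => //; exact: bm_cst. Qed.

Lemma bmMn n f : bounded_measurable f -> bounded_measurable (fun x => f x *+ n).
Proof.
by move=> bf; under eq_fun do rewrite -mulr_natl; exact: bmZ.
Qed.

Lemma bmB f g : bounded_measurable f -> bounded_measurable g ->
  bounded_measurable (fun x => f x - g x).
Proof.
move=> [mf [M hM]] [mg [N hN]]; split; first exact: measurable_funB.
exists (M + N) => x; exact: (le_trans (ler_normB _ _) (lerD (hM x) (hN x))).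
Qed.

Lemma bmX n f : bounded_measurable f -> bounded_measurable (fun x => f x ^+ n).
Proof.
move=> bf; elim: n => [|n ih]; first exact: bm_cst.
by under eq_fun do rewrite exprS; exact: bmM.
Qed.

Lemma bm_sum (I : Type) (s : seq I) (P : pred I) (F : I -> T -> R) :
  (forall i, bounded_measurable (F i)) ->
  bounded_measurable (fun x => \sum_(i <- s | P i) F i x).
Proof.
move=> bF; elim: s => [|i s ih].
  by under eq_fun do rewrite big_nil; exact: bm_cst.
under eq_fun do rewrite big_cons.
case: (P i) => //; exact: bmD.
Qed.

End BoundedMeasurable.

Lemma bm_comp d d' (T : measurableType d) (T' : measurableType d') (R : realType)
    (h : T' -> T) (f : T -> R) :
  measurable_fun setT h -> bounded_measurable f ->
  bounded_measurable (fun x => f (h x)).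
Proof.
move=> mh [mf [M hM]]; split; first exact: measurableT_comp.
by exists M.
Qed.

Lemma inv_measurable (R : realType) :
  measurable_fun [set: R] (fun x : R => x^-1).
Proof.
(* Inversion is continuous off 0 only; the point 0, where its value is the convention 0, is split
   off. *)
rewrite -(setvU [set 0]); apply/measurable_funU.
- by apply: measurableC; exact: measurable_set1.
- exact: measurable_set1.
split; last exact: measurable_fun_set1.
apply: open_continuous_measurable_fun.
  by rewrite openC; exact: accessible_closed_set1 (hausdorff_accessible (@Rhausdorff R)) _.
by move=> x; rewrite inE /= => /eqP x0; exact: inv_continuous.
Qed.

Lemma measurable_funV d (T : measurableType d) (R : realType) (f : T -> R) :
  measurable_fun setT f -> measurable_fun setT (fun x => (f x)^-1).
Proof. by move=> mf; apply: measurableT_comp => //; exact: inv_measurable. Qed.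

Section Expectation.
Context (d : measure_display) (T : measurableType d) (R : realType).
Variable P : probability T R.
Implicit Types (f g : T -> R).

Lemma bm_integrable f : bounded_measurable f -> P.-integrable setT (EFin \o f).
Proof.
move=> [mf [M hM]]; apply: measurable_bounded_integrable => //.
  by apply: le_lt_trans (probability_le1 P measurableT) _; rewrite ltry.
by exists M; split; [exact: num_real|move=> x Mx y _; exact: (le_trans (hM y) (ltW Mx))].
Qed.

Lemma Ex_cst c : \int[P]_x c = c.
Proof.
have e : fine (P setT) = 1 by rewrite (_ : P setT = 1%E) //; exact: probability_setT.
by rewrite Rintegral_cst // [X in _ * X]e mulr1.
Qed.

Lemma ExD f g : bounded_measurable f -> bounded_measurable g ->
  \int[P]_x (f x + g x) = \int[P]_x f x + \int[P]_x g x.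
Proof. by move=> bf bg; apply: RintegralD => //; exact: bm_integrable. Qed.

Lemma ExB f g : bounded_measurable f -> bounded_measurable g ->
  \int[P]_x (f x - g x) = \int[P]_x f x - \int[P]_x g x.
Proof. by move=> bf bg; apply: RintegralB => //; exact: bm_integrable. Qed.

Lemma ExZ c f : bounded_measurable f ->
  \int[P]_x (c * f x) = c * \int[P]_x f x.
Proof. by move=> bf; apply: RintegralZl => //; exact: bm_integrable. Qed.

Lemma Ex_sum (I : Type) (s : seq I) (Q : pred I) (F : I -> T -> R) :
  (forall i, bounded_measurable (F i)) ->
  \int[P]_x (\sum_(i <- s | Q i) F i x) = \sum_(i <- s | Q i) \int[P]_x F i x.
Proof.
move=> bF; elim: s => [|i s ih].
  by under eq_Rintegral do rewrite big_nil; rewrite Ex_cst big_nil.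
rewrite big_cons; under eq_Rintegral do rewrite big_cons.
case: (Q i) => //; rewrite ExD ?ih //; exact: bm_sum.
Qed.

Lemma le_Ex f g : bounded_measurable f -> bounded_measurable g ->
  (forall x, f x <= g x) -> \int[P]_x f x <= \int[P]_x g x.
Proof. by move=> bf bg fg; apply: le_Rintegral => //; exact: bm_integrable. Qed.

Lemma Ex_ge0 f : (forall x, 0 <= f x) -> 0 <= \int[P]_x f x.
Proof. by move=> f0; exact: Rintegral_ge0. Qed.

End Expectation.

(** Change of variables along a pushforward. With [h] a translation and [P' = P], it turns
    invariance of the measure of sets into invariance of integrals. *)
Lemma Ex_transfer d d' (T : measurableType d) (T' : measurableType d')
    (R : realType) (P : probability T R) (P' : probability T' R) (h : T -> T')
    (f : T' -> R) :
  measurable_fun setT h ->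
  (forall A, measurable A -> P (h @^-1` A) = P' A) ->
  bounded_measurable f ->
  \int[P]_x f (h x) = \int[P']_y f y.
Proof.
move=> mh hP bf; rewrite /Rintegral; congr fine.
have bfh := bm_comp mh bf.
pose Q : {measure set T' -> \bar R} := pushforward P h.
transitivity (\int[Q mh]_(y in setT) (f y)%:E)%E.
  symmetry; apply: integral_pushforward => //.
  - by apply/measurable_EFinP; exact: bf.1.
  - exact: (bm_integrable P bfh).
by apply: eq_measure_integral => A mA _; exact: hP.
Qed.

Section Fubini.
Context (d1 d2 : measure_display) (T1 : measurableType d1) (T2 : measurableType d2).
Context (R : realType) (P1 : probability T1 R) (P2 : probability T2 R).
Variable f : T1 -> T2 -> R.
Hypothesis bf : bounded_measurable (fun z : T1 * T2 => f z.1 z.2).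

Let intf : (P1 \x P2)%E.-integrable setT (EFin \o (fun z => f z.1 z.2)).
Proof. exact: (@bm_integrable _ _ _ (P1 \x P2)%E). Qed.

Lemma bm_pair1 x : bounded_measurable (f x).
Proof.
exact: (bm_comp (pair1_measurable x) bf).
Qed.

Lemma bm_pair2 y : bounded_measurable (f^~ y).
Proof.
exact: (bm_comp (pair2_measurable y) bf).
Qed.

Lemma Ex_swap : \int[P1]_x \int[P2]_y f x y = \int[P2]_y \int[P1]_x f x y.
Proof.
rewrite /Rintegral; congr fine.
have := Fubini intf => /= FF.
under eq_integral do rewrite fineK ?(integrable_fin_num _ (bm_integrable P2 (bm_pair1 _))) //.
under [RHS]eq_integral do rewrite fineK ?(integrable_fin_num _ (bm_integrable P1 (bm_pair2 _))) //.
exact: FF.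
Qed.

Lemma bm_Ex2 : bounded_measurable (fun x => \int[P2]_y f x y).
Proof.
split.
  apply: measurableT_comp => //.
  exact: (measurable_fubini_F intf).
have [_ [M hM]] := bf.
exists M => x; apply: (le_trans (le_normr_Rintegral _ _)) => //.
  exact: bm_integrable (bm_pair1 x).
rewrite -[leRHS](Ex_cst P2); apply: le_Ex.
- have [mf _] := bm_pair1 x; split; first exact: measurableT_comp.
  by exists M => y; rewrite normr_id; exact: (hM (x, y)).
- exact: bm_cst.
- by move=> y; exact: (hM (x, y)).
Qed.

End Fubini.

(** * Complex vectors *)

Section Complex.
Variable R : realType.
Implicit Types (z w : R[i]).

(** The squared modulus as an element of [R], so that inequalities and integrals stay real and
    [ring] can expand it. *)
Definition nsq z : R := Re z ^+ 2 + Im z ^+ 2.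

Lemma conjCE z : z^*%R = (Re z) -i* (Im z).
Proof. by case: z. Qed.

Lemma complexP z w : Re z = Re w -> Im z = Im w -> z = w.
Proof. by case: z w => [a b] [c e] /= -> ->. Qed.

Lemma ReD z w : Re (z + w) = Re z + Re w. Proof. by case: z w => [a b] [c e]. Qed.
Lemma ImD z w : Im (z + w) = Im z + Im w. Proof. by case: z w => [a b] [c e]. Qed.
Lemma ReN z : Re (- z) = - Re z. Proof. by case: z. Qed.
Lemma ImN z : Im (- z) = - Im z. Proof. by case: z. Qed.
Lemma ReM z w : Re (z * w) = Re z * Re w - Im z * Im w.
Proof. by case: z w => [a b] [c e]. Qed.
Lemma ImM z w : Im (z * w) = Re z * Im w + Im z * Re w.
Proof. by case: z w => [a b] [c e]. Qed.
Lemma ReJ z : Re (z^*)%R = Re z. Proof. by rewrite conjCE. Qed.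
Lemma ImJ z : Im (z^*)%R = - Im z. Proof. by rewrite conjCE. Qed.
Definition ReImE := (ReD, ImD, ReN, ImN, ReM, ImM, ReJ, ImJ).

Lemma Re_sum (I : Type) (s : seq I) (P : pred I) (F : I -> R[i]) :
  Re (\sum_(i <- s | P i) F i) = \sum_(i <- s | P i) Re (F i).
Proof. by apply: (big_morph _ ReD). Qed.

Lemma nsq_ge0 z : 0 <= nsq z. Proof. by rewrite addr_ge0 ?sqr_ge0. Qed.
Lemma nsqM z w : nsq (z * w) = nsq z * nsq w.
Proof. by rewrite /nsq !ReImE; ring. Qed.
Lemma nsqJ z : nsq (z^*)%R = nsq z.
Proof. by rewrite /nsq !ReImE sqrrN. Qed.
Lemma nsqN z : nsq (- z) = nsq z.
Proof. by rewrite /nsq !ReImE !sqrrN. Qed.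
Lemma nsqC (a : R) : nsq a%:C = a ^+ 2.
Proof. by rewrite /nsq /= expr0n addr0. Qed.
Lemma nsq0 : nsq 0 = 0. Proof. by rewrite /nsq /= !expr0n /= addr0. Qed.
Lemma nsq_eq0 z : (nsq z == 0) = (z == 0).
Proof.
rewrite paddr_eq0 ?sqr_ge0 // !sqrf_eq0 eq_complex /=; by [].
Qed.
Lemma nsq_normc z : Normc.normc z ^+ 2 = nsq z.
Proof. by case: z => a b; rewrite /Normc.normc sqr_sqrtr // addr_ge0 ?sqr_ge0. Qed.
Lemma mulJc z : (z^*)%R * z = (nsq z)%:C.
Proof. by apply: complexP; rewrite /nsq !ReImE /=; ring. Qed.
Lemma nsqD z w :
  nsq (z + w) = nsq z + nsq w + 2 * Re ((z^*)%R * w).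
Proof. by rewrite /nsq !ReImE; ring. Qed.

End Complex.

Section Vectors.
Variable R : realType.
Implicit Types (m n : nat).

Definition dot n (u v : 'cV[R[i]]_n) : R[i] := (u^t* *m v) 0 0.
Definition sqn n (u : 'cV[R[i]]_n) : R := \sum_i nsq (u i 0).

Lemma dotE n (u v : 'cV[R[i]]_n) : dot u v = \sum_i ((u i 0)^*)%R * v i 0.
Proof. by rewrite /dot mxE; apply: eq_bigr => i _; rewrite !mxE. Qed.

Lemma dotDr n (u v w : 'cV[R[i]]_n) : dot u (v + w) = dot u v + dot u w.
Proof. by rewrite /dot mulmxDr mxE. Qed.
Lemma dotNr n (u v : 'cV[R[i]]_n) : dot u (- v) = - dot u v.
Proof. by rewrite /dot mulmxN mxE. Qed.
Lemma dotBr n (u v w : 'cV[R[i]]_n) : dot u (v - w) = dot u v - dot u w.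
Proof. by rewrite dotDr dotNr. Qed.
Lemma dotZr n c (u v : 'cV[R[i]]_n) : dot u (c *: v) = c * dot u v.
Proof. by rewrite /dot -scalemxAr mxE. Qed.
Lemma dotJ n (u v : 'cV[R[i]]_n) : dot v u = ((dot u v)^*)%R.
Proof.
rewrite !dotE rmorph_sum; apply: eq_bigr => i _.
by rewrite rmorphM /= conjCK mulrC.
Qed.
Lemma dotDl n (u v w : 'cV[R[i]]_n) : dot (v + w) u = dot v u + dot w u.
Proof. by rewrite dotJ dotDr rmorphD /= (dotJ u v) (dotJ u w). Qed.
Lemma dotNl n (u v : 'cV[R[i]]_n) : dot (- v) u = - dot v u.
Proof. by rewrite dotJ dotNr rmorphN /= (dotJ u v). Qed.
Lemma dotBl n (u v w : 'cV[R[i]]_n) : dot (v - w) u = dot v u - dot w u.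
Proof. by rewrite dotDl dotNl. Qed.
Lemma dotZl n c (u v : 'cV[R[i]]_n) : dot (c *: v) u = (c^*)%R * dot v u.
Proof. by rewrite dotJ dotZr rmorphM /= (dotJ u v). Qed.
Lemma dot0r n (u : 'cV[R[i]]_n) : dot u 0 = 0.
Proof. by rewrite -(subrr u) dotBr subrr. Qed.
Lemma dot_mulr m n (A : 'M[R[i]]_(m, n)) u v : dot u (A *m v) = dot (A^t* *m u) v.
Proof. by rewrite /dot !trmx_mul !map_mxM /= trmxCK !mulmxA. Qed.
Lemma dotuu n (u : 'cV[R[i]]_n) : dot u u = (sqn u)%:C.
Proof.
rewrite dotE /sqn rmorph_sum; apply: eq_bigr => i _; exact: mulJc.
Qed.
Lemma nsq_dotC n (u v : 'cV[R[i]]_n) : nsq (dot u v) = nsq (dot v u).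
Proof. by rewrite dotJ nsqJ. Qed.

Lemma sqn_ge0 n (u : 'cV[R[i]]_n) : 0 <= sqn u.
Proof. by apply: sumr_ge0 => i _; exact: nsq_ge0. Qed.
Lemma sqnE n (u : 'cV[R[i]]_n) : sqn u = Re (dot u u).
Proof. by rewrite dotuu. Qed.
Lemma sqnZ n c (u : 'cV[R[i]]_n) : sqn (c *: u) = nsq c * sqn u.
Proof. by rewrite /sqn mulr_sumr; apply: eq_bigr => i _; rewrite mxE nsqM. Qed.
Lemma sqn0 n : sqn (0 : 'cV[R[i]]_n) = 0.
Proof. by rewrite /sqn big1 // => i _; rewrite mxE nsq0. Qed.
Lemma sqn_eq0 n (u : 'cV[R[i]]_n) : sqn u = 0 -> u = 0.
Proof.
move=> /eqP; rewrite psumr_eq0; last by move=> i _; exact: nsq_ge0.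
move=> /allP h; apply/colP => i; rewrite mxE; apply/eqP.
by rewrite -nsq_eq0; apply: (h i); rewrite mem_index_enum.
Qed.
Lemma sqnD n (u v : 'cV[R[i]]_n) :
  sqn (u + v) = sqn u + sqn v + 2 * Re (dot u v).
Proof.
rewrite /sqn dotE Re_sum mulr_sumr -!big_split /=; apply: eq_bigr => i _.
by rewrite mxE nsqD.
Qed.
Lemma sqnN n (u : 'cV[R[i]]_n) : sqn (- u) = sqn u.
Proof. by apply: eq_bigr => i _; rewrite mxE nsqN. Qed.
Lemma sqnB n (u v : 'cV[R[i]]_n) :
  sqn (u - v) = sqn u + sqn v - 2 * Re (dot u v).
Proof. by rewrite sqnD sqnN dotNr ReN mulrN. Qed.

(* [sqn] of [(sqn v) u - <v,u> v], divided by [sqn v]. *)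
Lemma cauchy_schwarz n (u v : 'cV[R[i]]_n) : nsq (dot u v) <= sqn u * sqn v.
Proof.
have [v0|v0] := eqVneq (sqn v) 0.
  by rewrite (sqn_eq0 v0) dot0r nsq0 sqn0 mulr0.
have vp : 0 < sqn v by rewrite lt_neqAle eq_sym v0 sqn_ge0.
have := sqn_ge0 ((sqn v)%:C *: u - dot v u *: v).
rewrite sqnB !sqnZ dotZl dotZr conjCE /= oppr0 nsqC.
move=> h; have {}h : 0 <= sqn v * (sqn u * sqn v - nsq (dot u v)).
  move: h; rewrite (dotJ v u) /nsq !ReImE /=.
  match goal with |- is_true (0 <= ?x) -> is_true (0 <= ?a) =>
    suff -> : a = x by [] end.
  by ring.
by rewrite pmulr_rge0 // subr_ge0 in h.
Qed.

Lemma isometry_dot m n (Q : 'M[R[i]]_(m, n)) u v : Q^t* *m Q = 1%:M ->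
  dot (Q *m u) (Q *m v) = dot u v.
Proof. by move=> QQ; rewrite dot_mulr mulmxA QQ mul1mx. Qed.

Lemma isometry_sqn m n (Q : 'M[R[i]]_(m, n)) u : Q^t* *m Q = 1%:M ->
  sqn (Q *m u) = sqn u.
Proof. by move=> QQ; rewrite !sqnE isometry_dot. Qed.

Lemma unitarymxC n (V : 'M[R[i]]_n) : V \is unitarymx -> V^t* *m V = 1%:M.
Proof. by move=> Vu; rewrite -invmx_unitary // mulVmx ?unitarymx_unit. Qed.

Lemma ketbraE n (u w : 'cV[R[i]]_n) : ketbra u *m w = dot u w *: u.
Proof.
rewrite /ketbra -mulmxA [u^t* *m w]mx11_scalar -/(dot u w) mul_mx_scalar.
by [].
Qed.
Lemma ketbraJ n (u : 'cV[R[i]]_n) : (ketbra u)^t* = ketbra u.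
Proof. by rewrite /ketbra trmx_mul map_mxM /= trmxCK. Qed.

Lemma mx_colP m n (A B : 'M[R[i]]_(m, n)) :
  (forall w : 'cV_n, A *m w = B *m w) -> A = B.
Proof.
move=> h; apply/matrixP => i j; have := h (delta_mx j 0).
by rewrite -!colE => /colP /(_ i); rewrite !mxE.
Qed.

(* The complex reflection along [a - b]; the factor [1 / (1 - <b, a>)] makes it
   map [a] to [b] exactly, not only up to a phase. *)
Lemma householder n (a b : 'cV[R[i]]_n) : sqn a = 1 -> sqn b = 1 ->
  exists V : 'M[R[i]]_n, [/\ V \is unitarymx, V *m a = b &
    forall w, dot a w = dot b w -> V *m w = w].
Proof.
move=> na nb; have [->|ab] := eqVneq a b.
  exists 1%:M; split; last by move=> w _; rewrite mul1mx.
    by apply/unitarymxP; rewrite trmx1 map_mx1 mulmx1.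
  by rewrite mul1mx.
set c := 1 - dot b a.
have sab : sqn (a - b) = 2 * Re c.
  by rewrite sqnB na nb dotJ /c !ReImE /=; ring.
have c0 : c != 0.
  apply: contra ab => /eqP c0; rewrite -subr_eq0; apply/eqP/sqn_eq0.
  by rewrite sab c0 mulr0.
pose V := 1%:M - c^-1 *: ketbra (a - b).
have VE w : V *m w = w - (c^-1 * dot (a - b) w) *: (a - b).
  by rewrite /V mulmxBl mul1mx -scalemxAl ketbraE scalerA.
(* As [2 * Re c = sqn (a - b)], this says that the coefficient of [ketbra (a - b)] in [V^t* *m V]
   vanishes. *)
have cc : c^-1 + (c^-1)^*%R = c^-1 * (c^-1)^*%R * (2 * Re c)%:C.
  have cJ0 : c^*%R != 0 by rewrite conjC_eq0.
  have -> : (2 * Re c)%:C = c + c^*%R by apply: complexP; rewrite !ReImE /=; ring.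
  by rewrite fmorphV /= mulrDr mulrAC mulVf // mul1r -mulrA mulVf // mulr1 addrC.
exists V; split.
- rewrite -trmxC_unitary; apply/unitarymxP; rewrite trmxCK.
  apply: mx_colP => w; rewrite mul1mx -mulmxA VE.
  have -> : V^t* = 1%:M - (c^-1)^*%R *: ketbra (a - b).
    by rewrite /V linearB linearZ /= map_mxB map_mxZ /= trmx1 map_mx1 ketbraJ.
  rewrite mulmxBl mul1mx -scalemxAl ketbraE scalerA dotBr dotZr dotuu sab.
  set t := dot (a - b) w; set e := a - b.
  rewrite -addrA -[RHS]addr0; congr (_ + _).
  rewrite -scaleNr -scalerBl.
  have -> : - (c^-1 * t) - (c^-1)^*%R * (t - c^-1 * t * (2 * Re c)%:C)
    = - t * (c^-1 + (c^-1)^*%R - c^-1 * (c^-1)^*%R * (2 * Re c)%:C) by ring.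
  by rewrite cc subrr mulr0 scale0r.
- rewrite VE dotBl dotuu na -/c mulVf // scale1r.
  by rewrite opprB addrC subrK.
- by move=> w aw; rewrite VE dotBl aw subrr mulr0 scale0r subr0.
Qed.

(* [0] when [u] or [v] vanishes, since [x / 0 = 0]. *)
Definition ov n (u v : 'cV[R[i]]_n) : R := nsq (dot u v) / (sqn u * sqn v).

Lemma ov_ge0 n (u v : 'cV[R[i]]_n) : 0 <= ov u v.
Proof. by rewrite divr_ge0 ?nsq_ge0 // mulr_ge0 ?sqn_ge0. Qed.
Lemma ov_le1 n (u v : 'cV[R[i]]_n) : ov u v <= 1.
Proof.
have [h|h] := eqVneq (sqn u * sqn v) 0; rewrite /ov.
  by rewrite h invr0 mulr0 ler01.
rewrite ler_pdivrMr ?mul1r ?cauchy_schwarz //.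
by rewrite lt_neqAle eq_sym h mulr_ge0 ?sqn_ge0.
Qed.
Lemma ovC n (u v : 'cV[R[i]]_n) : ov u v = ov v u.
Proof. by rewrite /ov nsq_dotC mulrC [sqn u * _]mulrC mulrC. Qed.
Lemma ovZr n c (u v : 'cV[R[i]]_n) : c != 0 -> ov u (c *: v) = ov u v.
Proof.
move=> c0; have c0' : nsq c != 0 by rewrite nsq_eq0.
rewrite /ov dotZr nsqM sqnZ mulrCA -mulf_div divff // mul1r; by [].
Qed.
Lemma ov_isometry m n (Q : 'M[R[i]]_(m, n)) u v : Q^t* *m Q = 1%:M ->
  ov (Q *m u) (Q *m v) = ov u v.
Proof. by move=> QQ; rewrite /ov isometry_dot // !isometry_sqn. Qed.
Lemma ov_mul n (u v : 'cV[R[i]]_n) : sqn u * sqn v * ov u v = nsq (dot u v).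
Proof.
have [h|h] := eqVneq (sqn u * sqn v) 0; last by rewrite /ov mulrCA divff ?mulr1.
rewrite h mul0r; apply/eqP; rewrite eq_le nsq_ge0 /=.
by have := cauchy_schwarz u v; rewrite h => ->.
Qed.
Lemma ov_self n (u : 'cV[R[i]]_n) : sqn u ^+ 2 * ov u u = sqn u ^+ 2.
Proof. by rewrite expr2 ov_mul dotuu nsqC. Qed.

(* Decompose [w = <u, w> u + w'] with [w'] orthogonal to [u]. *)
Lemma ov_lipschitz n (u v w : 'cV[R[i]]_n) :
  sqn u = 1 -> sqn v = 1 -> sqn w = 1 ->
  (ov w v - ov u v) ^+ 2 <= 10 * (1 - ov w u).
Proof.
move=> nu nv nw; rewrite (ovC w v) (ovC u v) (ovC w u) /ov !nu !nv !nw !mulr1 !divr1.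
set t := dot u w; pose w' := w - t *: u.
have nw' : sqn w' = 1 - nsq t.
  rewrite /w' sqnB sqnZ nu nw mulr1 dotZr dotJ -/t /nsq !ReImE; ring.
have dw' : dot v w = t * dot v u + dot v w'.
  by rewrite /w' dotBr dotZr addrC subrK.
have := cauchy_schwarz v w'; rewrite nv mul1r nw' dw'.
have := cauchy_schwarz v u; rewrite nv mul1r nu.
have : 0 <= 1 - nsq t by rewrite -nw' sqn_ge0.
set p := dot v u; set q := dot v w'.
move=> h1 h2 h3; rewrite nsqD nsqM.
have h4 : Re ((t * p)^*%R * q) ^+ 2 <= nsq q.
  apply: (@le_trans _ _ (nsq ((t * p)^*%R * q))).
    by rewrite /nsq lerDl sqr_ge0.
  rewrite nsqM nsqJ nsqM ler_piMl ?nsq_ge0 // -(mulr1 1) ler_pM ?nsq_ge0 //.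
  by rewrite -subr_ge0.
have p0 := nsq_ge0 p; have q0 := nsq_ge0 q; have t0 := nsq_ge0 t.
set y := Re _ in h4 *; set T := nsq t in h1 h3 t0 *; set P := nsq p in h2 p0 *.
set Q := nsq q in h3 h4 q0 *.
(* The difference of overlaps is [s + 2 * y] with [s = T * P + Q - P]. From [(s + 2 * y) ^+ 2 <= 2 *
   s ^+ 2 + 8 * y ^+ 2] and [y ^+ 2 <= Q <= 1 - T] comes the constant [10 = 2 + 8]. *)
have b1 : (T * P + Q - P) ^+ 2 <= (1 - T) ^+ 2.
  have l1 : T * P + Q - P <= 1 - T by nra.
  have l2 : - (1 - T) <= T * P + Q - P by nra.
  nra.
have b2 : (1 - T) ^+ 2 <= 1 - T by nra.
nra.
Qed.

End Vectors.

(** * Measurability of vector-valued functions *)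

Section Measurability.
Context (d : measure_display) (T : measurableType d) (R : realType).

Definition cmeasurable (f : T -> R[i]) :=
  measurable_fun setT (fun x => Re (f x)) /\
  measurable_fun setT (fun x => Im (f x)).

Definition vmeasurable n (xi : T -> 'cV[R[i]]_n) :=
  forall i, cmeasurable (fun x => xi x i 0).

Lemma cmeasurable_cst c : cmeasurable (fun=> c).
Proof. by split; exact: measurable_cst. Qed.

Lemma cmeasurableD f g : cmeasurable f -> cmeasurable g ->
  cmeasurable (fun x => f x + g x).
Proof.
move=> [f1 f2] [g1 g2]; split; under eq_fun do rewrite ReImE;
  exact: measurable_funD.
Qed.

Lemma cmeasurableM f g : cmeasurable f -> cmeasurable g ->
  cmeasurable (fun x => f x * g x).
Proof.
move=> [f1 f2] [g1 g2]; split; under eq_fun do rewrite ReImE.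
- by apply: measurable_funB; exact: measurable_funM.
- by apply: measurable_funD; exact: measurable_funM.
Qed.

Lemma cmeasurableJ f : cmeasurable f -> cmeasurable (fun x => (f x)^*%R).
Proof.
move=> [f1 f2]; split; under eq_fun do rewrite ReImE; first by [].
exact: measurable_funN.
Qed.

Lemma cmeasurable_sum (I : Type) (s : seq I) (P : pred I) (F : I -> T -> R[i]) :
  (forall i, cmeasurable (F i)) ->
  cmeasurable (fun x => \sum_(i <- s | P i) F i x).
Proof.
move=> mF; elim: s => [|i s ih].
  by under eq_fun do rewrite big_nil; exact: cmeasurable_cst.
under eq_fun do rewrite big_cons.
case: (P i) => //; exact: cmeasurableD.
Qed.

Lemma measurable_nsq f : cmeasurable f -> measurable_fun setT (fun x => nsq (f x)).
Proof. by move=> [f1 f2]; apply: measurable_funD; exact: measurable_funX. Qed.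

Lemma measurable_sum_fun (I : Type) (s : seq I) (F : I -> T -> R) :
  (forall i, measurable_fun setT (F i)) ->
  measurable_fun setT (fun x => \sum_(i <- s) F i x).
Proof.
move=> mF; elim: s => [|i s ih].
  by under eq_fun do rewrite big_nil; exact: measurable_cst.
under eq_fun do rewrite big_cons.
exact: measurable_funD.
Qed.

Lemma vmeasurable_cst n (v : 'cV[R[i]]_n) : vmeasurable (fun=> v).
Proof. by move=> i; exact: cmeasurable_cst. Qed.

Lemma vmeasurable_mulmx m n (A : 'M[R[i]]_(m, n)) (xi : T -> 'cV_n) :
  vmeasurable xi -> vmeasurable (fun x => A *m xi x).
Proof.
move=> mxi i; under eq_fun do rewrite mxE.
by apply: cmeasurable_sum => j; apply: cmeasurableM => //; exact: cmeasurable_cst.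
Qed.

Lemma vmeasurableD n (u v : T -> 'cV[R[i]]_n) :
  vmeasurable u -> vmeasurable v -> vmeasurable (fun x => u x + v x).
Proof. by move=> mu mv i; under eq_fun do rewrite mxE; exact: cmeasurableD. Qed.

Lemma vmeasurableZ n (c : T -> R[i]) (v : T -> 'cV[R[i]]_n) :
  cmeasurable c -> vmeasurable v -> vmeasurable (fun x => c x *: v x).
Proof. by move=> mu mv i; under eq_fun do rewrite mxE; exact: cmeasurableM. Qed.

Lemma cmeasurable_dot n (u v : T -> 'cV[R[i]]_n) :
  vmeasurable u -> vmeasurable v -> cmeasurable (fun x => dot (u x) (v x)).
Proof.
move=> mu mv; under eq_fun do rewrite dotE.
by apply: cmeasurable_sum => i; apply: cmeasurableM => //; exact: cmeasurableJ.
Qed.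

Lemma measurable_sqn n (u : T -> 'cV[R[i]]_n) :
  vmeasurable u -> measurable_fun setT (fun x => sqn (u x)).
Proof.
by move=> mu; apply: measurable_sum_fun => i; exact: measurable_nsq.
Qed.

Lemma bm_ov n (u v : T -> 'cV[R[i]]_n) :
  vmeasurable u -> vmeasurable v ->
  bounded_measurable (fun x => ov (u x) (v x)).
Proof.
move=> mu mv; split.
  apply: measurable_funM; first by apply: measurable_nsq; exact: cmeasurable_dot.
  by apply: measurable_funV; apply: measurable_funM; exact: measurable_sqn.
by exists 1 => x; rewrite ger0_norm ?ov_ge0 ?ov_le1.
Qed.

Definition bm_poly (p : T -> {poly R}) :=
  forall l, bounded_measurable (fun x => (p x)`_l).

Lemma bm_polyC (f : T -> R) : bounded_measurable f -> bm_poly (fun x => (f x)%:P).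
Proof.
move=> bf [|l]; under eq_fun do rewrite coefC /=; first by [].
exact: bm_cst.
Qed.

Lemma bm_polyD p q : bm_poly p -> bm_poly q -> bm_poly (fun x => p x + q x).
Proof. by move=> bp bq l; under eq_fun do rewrite coefD; exact: bmD. Qed.

Lemma bm_polyM p q : bm_poly p -> bm_poly q -> bm_poly (fun x => p x * q x).
Proof.
move=> bp bq l; under eq_fun do rewrite coefM.
by apply: bm_sum => j; exact: bmM.
Qed.

Lemma bm_polyX p n : bm_poly p -> bm_poly (fun x => p x ^+ n).
Proof.
move=> bp; elim: n => [|n ih].
  by under eq_fun do rewrite expr0 -polyC1; apply: bm_polyC; exact: bm_cst.
by under eq_fun do rewrite exprS; exact: bm_polyM.
Qed.

Lemma bm_poly_cst p : bm_poly (fun=> p).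
Proof. by move=> l; exact: bm_cst. Qed.

End Measurability.

(** * Polynomial identities and powers of a quadratic *)

Lemma eq_horner_poly (R : realType) (p q : {poly R}) :
  (forall s, p.[s] = q.[s]) -> p = q.
Proof.
move=> pq; apply/eqP; rewrite -subr_eq0; apply/eqP.
set r := p - q.
(* The test points [0, 1, 2, ...] are distinct and as many as the size of [r], more than a nonzero
   [r] has roots. *)
apply: (@roots_geq_poly_eq0 _ r [seq n%:R | n <- iota 0 (size r)]).
- by apply/allP => s _; rewrite /root hornerD hornerN pq subrr.
- rewrite map_inj_uniq ?iota_uniq // => a b /eqP; rewrite eqr_nat.
  by move=> /eqP.
- by rewrite size_map size_iota.
Qed.

Section Quadratic.
Variable R : comNzRingType.
Implicit Types (a b c : R).

Definition quadp a b c : {poly R} := a%:P + b%:P * 'X + c%:P * 'X^2.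

Lemma size_quadp a b c : (size (quadp a b c) <= 3)%N.
Proof.
apply: leq_trans (size_polyD _ _) _; rewrite geq_max; apply/andP; split.
  apply: leq_trans (size_polyD _ _) _; rewrite geq_max; apply/andP; split.
    by apply: leq_trans (size_polyC_leq1 _) _.
  rewrite mul_polyC; apply: leq_trans (size_scale_leq _ _) _.
  by rewrite size_polyX.
rewrite mul_polyC; apply: leq_trans (size_scale_leq _ _) _.
by rewrite size_polyXn.
Qed.

Lemma size_quadpX a b c k : (size (quadp a b c ^+ k) <= (2 * k).+1)%N.
Proof.
elim: k => [|k ih]; first by rewrite expr0 size_poly1.
rewrite exprS; apply: leq_trans (size_polyMleq _ _) _.
by have := size_quadp a b c; lia.
Qed.

Lemma horner_quadp a b c s : (quadp a b c).[s] = a + b * s + c * s ^+ 2.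
Proof. by rewrite /quadp !hornerE. Qed.

Lemma coef_quadp a b c l : (quadp a b c)`_l =
  if l is l'.+1 then if l' is l''.+1 then if l'' is 0%N then c else 0 else b else a.
Proof.
rewrite /quadp !coefD coefC !coefCM coefX coefXn.
by case: l => [|[|[|l]]]; rewrite /= ?mulr0 ?mulr1 ?addr0 ?add0r.
Qed.

(** The truncated exponents [k.-1] and [k.-2] are harmless: whenever the subtraction saturates, the
    multiplicity [k] or ['C(k, 2)] is 0. *)
Lemma coef012_quadpX a b c k :
  [/\ (quadp a b c ^+ k)`_0 = a ^+ k,
      (quadp a b c ^+ k)`_1 = a ^+ k.-1 * b *+ k &
      (quadp a b c ^+ k)`_2 =
        a ^+ k.-1 * c *+ k + a ^+ k.-2 * b ^+ 2 *+ 'C(k, 2)].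
Proof.
elim: k => [|k [h0 h1 h2]].
  by rewrite expr0 !coef1 !mulr0n addr0; split.
rewrite (exprS (quadp a b c)); split.
- by rewrite coefM big_ord_recl big_ord0 addr0 /= h0 coef_quadp exprS.
- rewrite coefM !big_ord_recl big_ord0 addr0 /= h0 h1 !coef_quadp.
  case: k {h0 h1 h2} => [|k]; first by rewrite mulr0n mulr0 add0r mulrC.
  rewrite !succnK [in RHS]mulrS [in RHS]exprS [b * _]mulrC addrC.
  by rewrite exprS mulrnAr !mulrA.
- rewrite coefM !big_ord_recl big_ord0 addr0 /= h0 h1 h2 !coef_quadp.
  case: k {h0 h1 h2} => [|[|k]] /=.
  + by rewrite !bin_small // !mulr0n !addr0 !mulr0 !add0r expr0 mul1r mulr1 mulr1n.
  + rewrite bin_small // binn !expr0 !expr1 !mul1r !mulr1n mulr0n addr0 mulr2n; ring.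
  + rewrite (binS k.+2 1) bin1 [in RHS]mulrnDr (mulrS _ k.+2) mulrDr !mulrnAr.
    rewrite (exprS a k.+1) (exprS a k).
    move: 'C(k.+2, 2) (a ^+ k) => C y.
    have -> : a * (a * y * c) *+ k.+2 = (a * (a * y) * c) *+ k.+2 by rewrite mulrA.
    have -> : a * (y * b ^+ 2) *+ C = (a * y * b ^+ 2) *+ C by rewrite mulrA.
    have -> : b * (a * y * b) *+ k.+2 = (a * y * b ^+ 2) *+ k.+2.
      by congr (_ *+ _); ring.
    rewrite [c * _]mulrC.
    move: (a * (a * y) * c) (a * y * b ^+ 2) => p q.
    move: (p *+ k.+2) (q *+ C) (q *+ k.+2) => u v w; ring.
Qed.

End Quadratic.

(** * Moments of isotropic vectors *)

Lemma ovZl (R : realType) n c (u v : 'cV[R[i]]_n) : c != 0 -> ov (c *: u) v = ov u v.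
Proof. by move=> c0; rewrite ovC ovZr // ovC. Qed.

Lemma dot_deltal (R : realType) n i (u : 'cV[R[i]]_n) : dot (delta_mx i 0) u = u i 0.
Proof.
rewrite dotE (bigD1 i) //= big1 => [|j ji]; rewrite !mxE ?eqxx ?rmorph1 ?mul1r ?addr0 //.
by rewrite (negbTE ji) rmorph0 mul0r.
Qed.

Lemma sqn_delta (R : realType) n i : sqn (delta_mx i 0 : 'cV[R[i]]_n) = 1.
Proof. by rewrite sqnE dot_deltal mxE !eqxx. Qed.

Lemma sum_ov_delta (R : realType) n (u : 'cV[R[i]]_n) : sqn u != 0 ->
  \sum_i ov (delta_mx i 0) u = 1.
Proof.
move=> u0; rewrite -(divff u0) [in RHS]/sqn mulr_suml; apply: eq_bigr => i _.
by rewrite /ov sqn_delta mul1r dot_deltal.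
Qed.

Section IsotropicMoments.
Context (d : measure_display) (T : measurableType d) (R : realType).
Variables (P : probability T R) (n : nat) (xi : T -> 'cV[R[i]]_n) (h : T -> R).
Hypothesis mxi : vmeasurable xi.
Hypothesis bh : bounded_measurable h.
Hypothesis h_xi0 : forall x, sqn (xi x) = 0 -> h x = 0.
Hypothesis isotropic : forall k (u w : 'cV[R[i]]_n), sqn u = 1 -> sqn w = 1 ->
  \int[P]_x (h x * ov u (xi x) ^+ k) = \int[P]_x (h x * ov w (xi x) ^+ k).

Let a i x := ov (delta_mx i 0) (xi x).
Let ba i : bounded_measurable (a i).
Proof. by apply: bm_ov => //; exact: vmeasurable_cst. Qed.

(** The middle coefficient of [|<e_i + s c e_j, xi>|^2 / |xi|^2] for [|c| = 1], a quadratic in the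
    real [s] whose outer coefficients are [a i] and [a j]. The phase [c] selects which real part of
    the cross term is seen. *)
Let b i j (c : R[i]) x :=
  2 * Re ((xi x i 0)^*%R * (c^*%R * xi x j 0)) / sqn (xi x).

Let b_le i j c x : nsq c = 1 -> `|b i j c x| <= 2.
Proof.
move=> c1; rewrite /b; set s := sqn _.
have [->|s0] := eqVneq s 0; first by rewrite invr0 mulr0 normr0.
have sp : 0 < s by rewrite lt_neqAle eq_sym s0 sqn_ge0.
rewrite normrM normfV (gtr0_norm sp) ler_pdivrMr // normrM ger0_norm //.
rewrite ler_pM2l //; set z := _ * _.
have : nsq z <= s ^+ 2.
  rewrite /z !nsqM !nsqJ c1 mul1r expr2.
  by apply: ler_pM; rewrite ?nsq_ge0 // /s /sqn;
    [rewrite (bigD1 i)|rewrite (bigD1 j)] => //=;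
    rewrite lerDl; apply: sumr_ge0 => l _; exact: nsq_ge0.
move=> hz; rewrite -ler_sqr ?nnegrE ?normr_ge0 ?sqn_ge0 // real_normK ?num_real //.
by apply: le_trans hz; rewrite lerDl sqr_ge0.
Qed.

Let bb i j c : nsq c = 1 -> bounded_measurable (b i j c).
Proof.
move=> c1; split; last by exists 2 => x; exact: b_le.
apply: measurable_funM; last by apply: measurable_funV; exact: measurable_sqn.
apply: measurable_funM; first exact: measurable_cst.
have [m1 _] : cmeasurable (fun x => (xi x i 0)^*%R * (c^*%R * xi x j 0)).
  apply: cmeasurableM; first exact: cmeasurableJ.
  by apply: cmeasurableM => //; exact: cmeasurable_cst.
exact: m1.
Qed.

Let p i j c k x := quadp (a i x) (b i j c x) (a j x) ^+ k.

Let bp i j c k : nsq c = 1 -> bm_poly (p i j c k).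
Proof.
move=> c1; apply: bm_polyX; apply: bm_polyD; first apply: bm_polyD.
- exact: bm_polyC.
- by apply: bm_polyM; [apply: bm_polyC; exact: bb|exact: bm_poly_cst].
- by apply: bm_polyM; [exact: bm_polyC|exact: bm_poly_cst].
Qed.

(** [ov] divides by the squared norm of its first argument, here [1 + s ^+ 2]; the prefactor undoes
    this and leaves a polynomial in [s]. *)
Let horner_p i j c k x s : i != j -> nsq c = 1 ->
  (p i j c k x).[s] =
  (1 + s ^+ 2) ^+ k * ov (delta_mx i 0 + (s%:C * c) *: delta_mx j 0) (xi x) ^+ k.
Proof.
move=> ij c1; rewrite /p horner_exp -exprMn; congr (_ ^+ _).
rewrite horner_quadp /ov.
have -> : sqn (delta_mx i 0 + (s%:C * c) *: delta_mx j 0 : 'cV[R[i]]_n) = 1 + s ^+ 2.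
  rewrite sqnD sqnZ !sqn_delta nsqM nsqC c1 !mulr1 dotZr dot_deltal mxE (negbTE ij).
  by rewrite mulr0 /= mulr0 addr0.
have cancel (X Y Z : R) : X != 0 -> X * (Y / (X * Z)) = Y / Z.
  by move=> X0; rewrite invfM mulrCA (mulrA X) divff // mul1r.
rewrite cancel; last by rewrite gt_eqF // ltr_pwDl // sqr_ge0.
rewrite dotDl dotZl !dot_deltal nsqD nsqM nsqJ nsqM nsqC c1 mulr1.
rewrite /a /b /ov !dot_deltal !sqn_delta !mul1r rmorphM /= (conjCE s%:C) /= oppr0.
by rewrite !ReImE /=; ring.
Qed.

(* The coefficient of [s ^ 2] in
   [E (h |<e_i + s c e_j, xi>|^2k / |xi|^2k) = (1 + s^2)^k E (h ov e_i xi ^ k)]. *)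
Let coef_p i j c k : i != j -> nsq c = 1 ->
  \int[P]_x (h x * (a i x ^+ k * a j x *+ k.+1
     + a i x ^+ k.-1 * b i j c x ^+ 2 *+ 'C(k.+1, 2))) =
  k.+1%:R * \int[P]_x (h x * a i x ^+ k.+1).
Proof.
move=> ij c1; set I := \int[P]_x (h x * a i x ^+ k.+1).
pose m := (2 * k.+1).+1.
(* The expectation of a random polynomial, taken coefficientwise. Isotropy gives its value at every
   [s], hence the polynomial itself. *)
pose q := \poly_(l < m) \int[P]_x (h x * (p i j c k.+1 x)`_l).
have bhp l : bounded_measurable (fun x => h x * (p i j c k.+1 x)`_l).
  by apply: bmM => //; exact: bp.
have : q = I *: quadp 1 0 1 ^+ k.+1.
  apply: eq_horner_poly => s.
  rewrite horner_poly hornerZ horner_exp horner_quadp mul0r addr0 mul1r.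
  transitivity (\int[P]_x (h x * (p i j c k.+1 x).[s])).
    under [LHS]eq_bigr do rewrite mulrC -ExZ //.
    rewrite -Ex_sum; last by move=> l; exact: bmZ.
    apply: eq_Rintegral => x _; rewrite (@horner_coef_wide _ m) ?size_quadpX //.
    by rewrite mulr_sumr; apply: eq_bigr => l _; ring.
  set w := delta_mx i 0 + (s%:C * c) *: delta_mx j 0 : 'cV[R[i]]_n.
  under eq_Rintegral do rewrite horner_p // mulrCA -/w.
  (* Isotropy compares unit vectors only, so [w] is divided by its norm [r]; [ov] does not
     notice. *)
  pose r := Num.sqrt (1 + s ^+ 2).
  have s2 : 0 < 1 + s ^+ 2 by rewrite ltr_pwDl // sqr_ge0.
  have r0 : r != 0 by rewrite sqrtr_eq0 -ltNge.
  have rr : r ^+ 2 = 1 + s ^+ 2 by rewrite sqr_sqrtr // ltW.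
  have rC0 : (r^-1)%:C != 0 by rewrite eq_complex /= eqxx andbT invr_eq0.
  have nw : sqn ((r^-1)%:C *: w) = 1.
    rewrite sqnZ nsqC /w sqnD sqnZ !sqn_delta nsqM nsqC c1 !mulr1 dotZr dot_deltal.
    by rewrite mxE (negbTE ij) mulr0 /= mulr0 addr0 exprVn rr mulVf // gt_eqF.
  rewrite ExZ; last first.
    by apply: bmM => //; apply: bmX; apply: bm_ov => //; exact: vmeasurable_cst.
  rewrite [RHS]mulrC; congr (_ * _).
  transitivity (\int[P]_x (h x * ov ((r^-1)%:C *: w) (xi x) ^+ k.+1)).
    by apply: eq_Rintegral => x _; rewrite ovZl.
  exact: (isotropic k.+1 nw (sqn_delta R i)).
move=> /(congr1 (fun q : {poly R} => q`_2)).
rewrite coef_poly (_ : (2 < m)%N); last by rewrite /m; lia.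
rewrite coefZ; have [_ _ ->] := coef012_quadpX 1 0 (1 : R) k.+1.
rewrite !expr1n expr0n /= mul1r mulr0 mul0rn addr0 mulrC => <-.
apply: eq_Rintegral => x _; congr (_ * _).
by have [_ _ ->] := coef012_quadpX (a i x) (b i j c x) (a j x) k.+1.
Qed.

(* Summing [coef_p] over [c = 1] and [c = 'i] turns the squares of the cross
   terms into [a i * a j]. *)
Lemma isotropic_mixed i j k : i != j ->
  k.+1%:R * \int[P]_x (h x * (ov (delta_mx i 0) (xi x) ^+ k * ov (delta_mx j 0) (xi x)))
  = \int[P]_x (h x * ov (delta_mx i 0) (xi x) ^+ k.+1).
Proof.
move=> ij; rewrite -/(a i).
have c1 : nsq (1 : R[i]) = 1 by rewrite /nsq /= expr1n expr0n /= addr0.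
have ci : nsq ('i%C : R[i]) = 1 by rewrite /nsq /= expr1n expr0n /= add0r.
have e1 := coef_p k ij c1; have e2 := coef_p k ij ci.
set I := \int[P]_x (h x * a i x ^+ k.+1) in e1 e2 *.
have bterm c : nsq c = 1 -> bounded_measurable (fun x => h x * (a i x ^+ k * a j x *+ k.+1
     + a i x ^+ k.-1 * b i j c x ^+ 2 *+ 'C(k.+1, 2))).
  move=> cc; apply: bmM => //; apply: bmD; apply: bmMn; apply: bmM => //.
  - exact: bmX.
  - exact: bmX.
  - by apply: bmX; exact: bb.
have : 2 * (k.+1%:R * (k.+1%:R *
    \int[P]_x (h x * (a i x ^+ k * a j x)))) = 2 * (k.+1%:R * I).
  rewrite [RHS]mulr_natl mulr2n -[X in _ = X + _]e1 -e2 -ExD; [|exact: bterm|exact: bterm].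
  rewrite !mulrA -ExZ; last by apply: bmM => //; apply: bmM => //; exact: bmX.
  apply: eq_Rintegral => x _.
  have bsq : b i j 1 x ^+ 2 + b i j 'i%C x ^+ 2 = 4 * (a i x * a j x).
    rewrite /b /a /ov !sqn_delta !mul1r !dot_deltal /nsq !ReImE /=; ring.
  (* Together with the two direct terms the coefficient is [2 (k + 1) + 4 binom(k + 1, 2) = 2 (k +
     1)^2], against [2 (k + 1)] on the right: one factor [k + 1] survives. *)
  have key : a i x ^+ k.-1 * b i j 1 x ^+ 2 *+ 'C(k.+1, 2)
      + a i x ^+ k.-1 * b i j 'i%C x ^+ 2 *+ 'C(k.+1, 2)
      = 2 * (k.+1%:R * k%:R) * (a i x ^+ k * a j x).
    rewrite -mulrnDl -mulrDr bsq.
    case: k {e1 e2 I bterm} => [|k]; first by rewrite bin_small // mulr0n !mulr0 mul0r.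
    have e : k.+2%:R * k.+1%:R = 2 * 'C(k.+2, 2)%:R :> R.
      by rewrite -!natrM -(mul_bin_diag k.+2 1) bin1.
    rewrite e -[LHS]mulr_natl exprS succnK.
    by move: 'C(_, _)%:R (a i x ^+ k) => C y; ring.
  move: key; rewrite -[_ * _ *+ k.+1]mulr_natl -(natr1 k).
  move: (_ *+ 'C(_, _)) (_ *+ 'C(_, _)) => u v key.
  rewrite -mulrDr addrACA key; ring.
have n2 : (2 : R) != 0 by rewrite pnatr_eq0.
have nk : (k.+1%:R : R) != 0 by rewrite pnatr_eq0.
by move=> /(mulfI n2) /(mulfI nk).
Qed.

(** The overlaps with a basis sum to 1, so inserting that sum gives [E h a^k = (1 + (n - 1) / (k +
    1)) E h a^(k + 1)], which is the recursion of the inverse binomials. Where [xi] vanishes the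
    overlaps sum to 0 instead, and [h_xi0] keeps the identity true. *)
Lemma isotropic_moment k (w : 'cV[R[i]]_n) : sqn w = 1 ->
  \int[P]_x (h x * ov w (xi x) ^+ k) = (\int[P]_x h x) / 'C(n + k - 1, k)%:R.
Proof.
move=> nw.
have n0 : (0 < n)%N.
  rewrite lt0n; apply: contra_eq_neq nw => n0.
  rewrite /sqn big1 => [|[i hi] _]; first by rewrite eq_sym oner_eq0.
  by exfalso; rewrite n0 in hi.
pose i0 := Ordinal n0.
rewrite (isotropic k nw (sqn_delta R i0)) -/(a i0).
elim: k => [|k ih].
  rewrite bin0 divr1; apply: eq_Rintegral => x _.
  by rewrite expr0 mulr1.
set I := LHS.
have : \int[P]_x (h x * a i0 x ^+ k) = I * (n + k)%:R / k.+1%:R.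
  transitivity (\int[P]_x (\sum_j h x * (a i0 x ^+ k * a j x))).
    apply: eq_Rintegral => x _; rewrite -!mulr_sumr.
    have [s0|s0] := eqVneq (sqn (xi x)) 0; first by rewrite h_xi0 // !mul0r.
    by rewrite sum_ov_delta // mulr1.
  rewrite Ex_sum; last first.
    by move=> j; apply: bmM => //; apply: bmM => //; exact: bmX.
  rewrite (bigD1 i0) //= (eq_bigr (fun=> I / k.+1%:R)); last first.
    move=> j ji; apply: (mulfI (_ : k.+1%:R != 0)); first by rewrite pnatr_eq0.
    rewrite isotropic_mixed 1?eq_sym // [RHS]mulrC divfK ?pnatr_eq0 //.
  rewrite sumr_const cardC1 card_ord.
  under eq_Rintegral do rewrite -exprSr.
  rewrite -/I -[_ *+ n.-1]mulr_natr.
  have -> : n.-1%:R = n%:R - 1 :> R by rewrite -subn1 natrB.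
  rewrite natrD -(natr1 k).
  have k0 : k%:R + 1 != 0 :> R by rewrite natr1 pnatr_eq0.
  by field.
rewrite ih => e.
have k0 : k.+1%:R != 0 :> R by rewrite pnatr_eq0.
have nk0 : (n + k)%:R != 0 :> R by rewrite pnatr_eq0; lia.
have C0 : 'C(n + k - 1, k)%:R != 0 :> R by rewrite pnatr_eq0 -lt0n bin_gt0; lia.
have C1 : 'C(n + k.+1 - 1, k.+1)%:R != 0 :> R by rewrite pnatr_eq0 -lt0n bin_gt0; lia.
have := mul_bin_diag (n + k) k.
rewrite -subn1 => /(congr1 (fun m => m%:R : R)); rewrite !natrM.
rewrite (_ : n + k.+1 - 1 = n + k)%N in C1 *; last by lia.
move=> e2; have -> : I = I * (n + k)%:R / k.+1%:R * k.+1%:R / (n + k)%:R.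
  by move: (n + k)%:R nk0 (k.+1%:R) k0 => N N0 K K0; field; rewrite N0 K0.
rewrite -e; have -> : 'C(n + k, k.+1)%:R = (n + k)%:R * 'C(n + k - 1, k)%:R / k.+1%:R :> R.
  by rewrite e2 mulrAC divff // mul1r.
move: (n + k)%:R nk0 (k.+1%:R) k0 'C(_, _)%:R C0 => N N0 K K0 C CC.
by field; rewrite CC N0 K0.
Qed.

End IsotropicMoments.

(** * Haar measures *)

Lemma mx_entry_continuous (T : topologicalType) m n i j :
  continuous (fun M : 'M[T]_(m, n) => M i j).
Proof.
move=> M A MA.
exists (fun i' j' => if (i' == i) && (j' == j) then A else setT) => [i' j'|N /= hN].
  by case: ifPn => [/andP[/eqP -> /eqP ->]|_] //; exact: filterT.
by have := hN i j; rewrite !eqxx.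
Qed.

Lemma continuous_mx (X T : topologicalType) m n (f : X -> 'M[T]_(m, n)) :
  (forall i j, continuous (fun x => f x i j)) -> continuous f.
Proof.
move=> cf x A [P fP sPA].
have : \forall y \near x, forall i j, P i j (f y i j).
  apply: filter_forall => i; apply: filter_forall => j.
  exact: (cf i j x _ (fP i j)).
by apply: filterS => y hy; exact: sPA.
Qed.

Lemma Re_continuous (R : realType) : continuous (fun z : R[i]^o => Re z).
Proof.
move=> z A /nbhs_ballP[e e0 eA].
apply/nbhs_ballP; exists e%:C; first by rewrite /= ltcR.
move=> w /= zw; apply: eA; rewrite /ball /= -ReN -ReD -ltcR.
by apply: le_lt_trans (normc_ge_Re _) _.
Qed.

Lemma Im_continuous (R : realType) : continuous (fun z : R[i]^o => Im z).
Proof.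
move=> z A /nbhs_ballP[e e0 eA].
apply/nbhs_ballP; exists e%:C; first by rewrite /= ltcR.
move=> w /= zw; apply: eA; rewrite /ball /= -ImN -ImD -ltcR.
set u : R[i] := z - w.
(* Multiplication by a number of modulus 1 reduces the imaginary part to the bound on real parts. *)
have -> : Im u = Re (- ('i%C * u)).
  by rewrite !ReImE /=; ring.
apply: le_lt_trans (normc_ge_Re _) _.
rewrite normrN normrM (_ : `|'i%C| = 1) ?mul1r //.
by rewrite normc_def /= expr0n expr1n /= add0r sqrtr1.
Qed.

Lemma continuous_borel_measurable (T : ptopologicalType) (R : realType)
    (f : T -> R) :
  continuous f -> measurable_fun [set: borel T] (f : borel T -> R).
Proof.
move=> /continuousP cf; apply: (measurability _ (RGenOpens.measurableE R)).
move=> _ [_ [a [b ->] <-]]; rewrite setTI; apply: sub_sigma_algebra.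
exact/cf/interval_open.
Qed.

Lemma continuous_borel_borel (S T : ptopologicalType) (f : S -> T) :
  continuous f -> measurable_fun [set: borel S] (f : borel S -> borel T).
Proof.
move=> /continuousP cf; apply: (@measurability _ _ (borel S) (borel T) setT f (@open T) erefl).
move=> _ [A oA <-]; rewrite setTI; apply: sub_sigma_algebra.
exact: cf.
Qed.

Lemma continuous_set_val_entry (R : realType) m n (S : set 'M[R[i]^o]_(m, n)) i j :
  continuous (fun x : set_type S => (set_val x : 'M[R[i]^o]_(m, n)) i j).
Proof.
move=> x.
apply: (@continuous_comp (set_type S) 'M[R[i]^o]_(m, n) R[i]^o set_val
  (fun M => M i j)); first exact: initial_continuous.
exact: mx_entry_continuous.
Qed.

Lemma set_val_entry_measurable (R : realType) m n (S : set 'M[R[i]^o]_(m, n)) i j :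
  continuous (fun x : set_type S => Re ((set_val x : 'M[R[i]^o]_(m, n)) i j)) /\
  continuous (fun x : set_type S => Im ((set_val x : 'M[R[i]^o]_(m, n)) i j)).
Proof.
pose e (x : set_type S) := (set_val x : 'M[R[i]^o]_(m, n)) i j.
split=> x.
- apply: (@continuous_comp (set_type S) R[i]^o R e (fun z => Re z)).
    exact: continuous_set_val_entry.
  exact: Re_continuous.
- apply: (@continuous_comp (set_type S) R[i]^o R e (fun z => Im z)).
    exact: continuous_set_val_entry.
  exact: Im_continuous.
Qed.

Lemma continuous_csum (R : realType) (X : topologicalType) (I : Type) (s : seq I)
    (F : I -> X -> R[i]^o) :
  (forall i, continuous (F i)) -> continuous (fun x => \sum_(i <- s) F i x).
Proof.
move=> cF; elim: s => [|i s ih] x.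
  by under [X in continuous_at _ X]eq_fun do rewrite big_nil; exact: cst_continuous.
under [X in continuous_at _ X]eq_fun do rewrite big_cons.
by apply: continuousD; [exact: cF|exact: ih].
Qed.

(** Covers left and right translation of unitaries and rotation of states at once, with the identity
    matrix on the idle side. *)
Lemma continuous_set_val_mul (R : realType) m n (S S' : set 'M[R[i]^o]_(m, n))
    (A : 'M[R[i]]_m) (B : 'M[R[i]]_n) (f : set_type S -> set_type S') :
  (forall x, (set_val (f x) : 'M[R[i]]_(m, n)) = A *m (set_val x : 'M[R[i]]_(m, n)) *m B) ->
  continuous f.
Proof.
move=> fE; apply: continuous_comp_initial; apply: continuous_mx => i j x.
rewrite [X in continuous_at _ X](_ : _ = (fun y =>
  \sum_l ((\sum_k A i k * (set_val y : 'M[R[i]]_(m, n)) k l) * B l j) : R[i]^o)); last first.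
  apply/funext => y /=; rewrite fE mxE; apply: eq_bigr => l _.
  by rewrite mxE.
apply: continuous_csum => l {}x.
apply: continuousM; last exact: cst_continuous.
apply: continuous_csum => k {}x.
apply: continuousM; first exact: cst_continuous.
exact: continuous_set_val_entry.
Qed.

Section HaarUnitary.
Variables (R : realType) (n : nat).
Local Notation UG := (borel (unitary_group R n)).

Lemma unitary_entry_measurable i j :
  cmeasurable (fun U : UG => unitary_mx U i j).
Proof.
by have [c1 c2] := @set_val_entry_measurable R n n (@unitary_set R n) i j;
  split; exact: continuous_borel_measurable.
Qed.

Lemma unitary_vec_measurable (phi : 'cV[R[i]]_n) :
  vmeasurable (fun U : UG => unitary_mx U *m phi).
Proof.
move=> i; under eq_fun do rewrite mxE.
apply: cmeasurable_sum => j; apply: cmeasurableM; last exact: cmeasurable_cst.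
exact: unitary_entry_measurable.
Qed.

Lemma unitary_mull_measurable (V : unitary_group R n) :
  measurable_fun [set: UG] (unitary_mul V : UG -> UG).
Proof.
apply: continuous_borel_borel.
apply: (continuous_set_val_mul (A := unitary_mx V) (B := 1%:M)) => U.
by rewrite mulmx1.
Qed.

Lemma unitary_mulr_measurable (V : unitary_group R n) :
  measurable_fun [set: UG] ((fun U => unitary_mul U V) : UG -> UG).
Proof.
apply: continuous_borel_borel.
apply: (continuous_set_val_mul (A := 1%:M) (B := unitary_mx V)) => U.
by rewrite mul1mx.
Qed.

Variable mu : probability UG R.
Hypothesis hmu : is_haar mu.

Lemma haar_Ex_mull V (f : UG -> R) : bounded_measurable f ->
  \int[mu]_U f (unitary_mul V U) = \int[mu]_U f U.
Proof.
move=> bf; apply: Ex_transfer => //; first exact: unitary_mull_measurable.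
by move=> A mA; exact: (hmu V mA).1.
Qed.

Lemma haar_Ex_mulr V (f : UG -> R) : bounded_measurable f ->
  \int[mu]_U f (unitary_mul U V) = \int[mu]_U f U.
Proof.
move=> bf; apply: (@Ex_transfer _ _ UG UG R mu mu (fun U => unitary_mul U V) f) => //.
  exact: unitary_mulr_measurable.
by move=> A mA; exact: (hmu V mA).2.
Qed.

End HaarUnitary.

Section HaarState.
Variables (R : realType) (N : nat).
Local Notation PS := (borel (pure_state R N)).

Lemma state_vec_measurable : vmeasurable (fun v : PS => state_vec v).
Proof.
move=> i.
by have [c1 c2] := @set_val_entry_measurable R _ _ (@unit_vectors R N) i 0;
  split; exact: continuous_borel_measurable.
Qed.

Lemma sqn_state_vec (v : pure_state R N) : sqn (state_vec v) = 1.
Proof.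
have e : (state_vec v)^t* *m state_vec v = 1%:M by exact: (set_mem (svalP v)).
by rewrite sqnE /dot e mxE.
Qed.

Lemma rotate_measurable (V : unitary_group R (2 ^ N)) :
  measurable_fun [set: PS] (rotate V : PS -> PS).
Proof.
apply: continuous_borel_borel.
apply: (continuous_set_val_mul (A := unitary_mx V) (B := 1%:M)) => U.
by rewrite mulmx1.
Qed.

Variable nu : probability PS R.
Hypothesis hnu : is_haar_state nu.

Lemma haar_Ex_rotate V (f : PS -> R) : bounded_measurable f ->
  \int[nu]_v f (rotate V v) = \int[nu]_v f v.
Proof.
move=> bf; apply: Ex_transfer => //; first exact: rotate_measurable.
by move=> A mA; exact: (hnu V mA).
Qed.

End HaarState.

(** * Unitaries acting on one block, and the moments they determine *)

Lemma unitary_of_mx (R : realType) n (V : 'M[R[i]]_n) : V \is unitarymx ->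
  exists V' : unitary_group R n, unitary_mx V' = V.
Proof.
move=> Vu; have h : (V : 'M[R[i]^o]_n) \in @unitary_set R n by exact/mem_set.
by exists (exist _ (V : 'M[R[i]^o]_n) h).
Qed.

(** Bessel's inequality, from the nonnegativity of the squared distance between [y] and its
    projection on the range of [Q]. *)
Lemma sqn_adj_le (R : realType) m n (Q : 'M[R[i]]_(m, n)) y :
  Q^t* *m Q = 1%:M -> sqn (Q^t* *m y) <= sqn y.
Proof.
move=> QQ; set x := Q^t* *m y.
have := sqn_ge0 (y - Q *m x); rewrite sqnB isometry_sqn // dot_mulr -/x dotuu /=.
lra.
Qed.

Section BlockUnitary.
Variables (R : realType) (m n : nat) (Q : 'M[R[i]]_(m, n)).
Hypothesis QQ : Q^t* *m Q = 1%:M.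

(** Acts as [V] on the range of the isometry [Q] and as the identity on its orthogonal
    complement. *)
Definition block_unitary (V : 'M[R[i]]_n) : 'M[R[i]]_m :=
  Q *m V *m Q^t* + (1%:M - Q *m Q^t*).

Lemma adj_block_unitary V : Q^t* *m block_unitary V = V *m Q^t*.
Proof.
rewrite /block_unitary mulmxDr mulmxBr mulmx1 !mulmxA QQ !mul1mx subrr addr0.
by [].
Qed.

Lemma block_unitary_orth p (E : 'M[R[i]]_(p, m)) V : E *m Q = 0 ->
  E *m block_unitary V = E.
Proof.
move=> EQ; rewrite /block_unitary mulmxDr mulmxBr mulmx1 !mulmxA EQ !mul0mx.
by rewrite subr0 add0r.
Qed.

Lemma adj_block V : (block_unitary V)^t* = block_unitary (V^t*).
Proof.
rewrite /block_unitary !linearD !linearN /= !map_mxD !map_mxN !trmx_mul !map_mxM /=.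
by rewrite trmx1 map_mx1 !trmxCK mulmxA.
Qed.

Lemma block_unitaryP V : V \is unitarymx -> block_unitary V \is unitarymx.
Proof.
move=> /unitarymxP VV; apply/unitarymxP; rewrite adj_block.
have QB := adj_block_unitary (V^t*).
have BE : block_unitary (V^t*) = Q *m V^t* *m Q^t* + (1%:M - Q *m Q^t*) by [].
move: (block_unitary (V^t*)) QB BE => B QB BE.
rewrite /block_unitary mulmxDl mulmxBl mul1mx -!mulmxA QB (mulmxA V) VV mul1mx.
by rewrite BE !mulmxA [X in _ + (X - _)]addrC addrK addrC subrK.
Qed.

End BlockUnitary.

Section StateMoments.
Variables (R : realType) (N : nat).
Local Notation PS := (borel (pure_state R N)).
Variable nu : probability PS R.
Hypothesis hnu : is_haar_state nu.
Local Notation "'D_' k" := ('C(2 ^ N + k - 1, k)%:R : R) (at level 8, k at level 2).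

Lemma state_moment k (w : 'cV[R[i]]_(2 ^ N)) : sqn w = 1 ->
  \int[nu]_v ov w (state_vec v) ^+ k = (D_ k)^-1.
Proof.
move=> nw.
have mv := @state_vec_measurable R N.
have bo u l : bounded_measurable (fun v : PS => 1 * ov u (state_vec v) ^+ l).
  by apply: bmZ; apply: bmX; apply: bm_ov => //; exact: vmeasurable_cst.
transitivity (\int[nu]_v (1 * ov w (state_vec v) ^+ k)).
  by apply: eq_Rintegral => v _; rewrite mul1r.
rewrite (@isotropic_moment _ PS R nu _ (fun v => state_vec v) (fun=> 1) mv
  (bm_cst _ 1)) ?Ex_cst ?div1r //.
  by move=> v; rewrite sqn_state_vec => /eqP; rewrite oner_eq0.
move=> l a b na nb; have [V [Vu Vab _]] := householder nb na.
have [V' VE] := unitary_of_mx Vu.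
rewrite -(haar_Ex_rotate hnu V' (bo a l)); apply: eq_Rintegral => v _.
have -> : state_vec (rotate V' v) = V *m state_vec v by rewrite -VE.
by rewrite -Vab ov_isometry //; exact: unitarymxC.
Qed.

End StateMoments.

Section UnitaryMoments.
Variables (R : realType) (m : nat).
Local Notation UG := (borel (unitary_group R m)).
Variable mu : probability UG R.
Hypothesis hmu : is_haar mu.

Lemma sqn_unitary (U : unitary_group R m) phi : sqn (unitary_mx U *m phi) = sqn phi.
Proof. by rewrite isometry_sqn //; apply: unitarymxC; exact: unitary_mxP. Qed.

Lemma bm_sqn_block n (Q : 'M[R[i]]_(m, n)) (phi : 'cV_m) : Q^t* *m Q = 1%:M ->
  bounded_measurable (fun U : UG => sqn (Q^t* *m (unitary_mx U *m phi))).
Proof.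
move=> QQ; split.
  apply: measurable_sqn; apply: vmeasurable_mulmx; exact: unitary_vec_measurable.
exists (sqn phi) => U; rewrite ger0_norm ?sqn_ge0 //.
by apply: le_trans (sqn_adj_le _ QQ) _; rewrite sqn_unitary.
Qed.

(** Translating [U] by the block unitary of some [V] with [V *m b = a] moves the block vector by [V]
    and leaves the weight [G] unchanged. *)
Lemma unitary_isotropic n (Q : 'M[R[i]]_(m, n)) (phi : 'cV_m) (G : UG -> R) :
  Q^t* *m Q = 1%:M -> bounded_measurable G ->
  (forall V W, V \is unitarymx -> unitary_mx W = block_unitary Q V ->
     forall U, G (unitary_mul W U) = G U) ->
  forall k (a b : 'cV_n), sqn a = 1 -> sqn b = 1 ->
  \int[mu]_U (G U * sqn (Q^t* *m (unitary_mx U *m phi))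
              * ov a (Q^t* *m (unitary_mx U *m phi)) ^+ k) =
  \int[mu]_U (G U * sqn (Q^t* *m (unitary_mx U *m phi))
              * ov b (Q^t* *m (unitary_mx U *m phi)) ^+ k).
Proof.
move=> QQ bG invG k a b na nb; have [V [Vu Vab _]] := householder nb na.
have [W WE] := unitary_of_mx (block_unitaryP QQ Vu).
set f := fun U : UG => G U * sqn (Q^t* *m (unitary_mx U *m phi))
              * ov a (Q^t* *m (unitary_mx U *m phi)) ^+ k.
have bf : bounded_measurable f.
  apply: bmM; first by apply: bmM => //; exact: bm_sqn_block.
  apply: bmX; apply: bm_ov; first exact: vmeasurable_cst.
  by apply: vmeasurable_mulmx; exact: unitary_vec_measurable.
rewrite -(haar_Ex_mull hmu W bf); apply: eq_Rintegral => U _; rewrite /f.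
have -> : Q^t* *m (unitary_mx (unitary_mul W U) *m phi) =
          V *m (Q^t* *m (unitary_mx U *m phi)).
  have -> : unitary_mx (unitary_mul W U) = block_unitary Q V *m unitary_mx U.
    by rewrite -WE.
  by rewrite !mulmxA adj_block_unitary.
have VV := unitarymxC Vu.
by rewrite (invG _ _ Vu WE) isometry_sqn // -Vab ov_isometry.
Qed.

(** The factor [sqn] of the block vector makes the weight vanish together with that vector, as
    [isotropic_moment] demands. *)
Lemma unitary_moment n (Q : 'M[R[i]]_(m, n)) (phi : 'cV_m) (G : UG -> R) k w :
  Q^t* *m Q = 1%:M -> bounded_measurable G ->
  (forall V W, V \is unitarymx -> unitary_mx W = block_unitary Q V ->
     forall U, G (unitary_mul W U) = G U) ->
  sqn w = 1 ->
  \int[mu]_U (G U * sqn (Q^t* *m (unitary_mx U *m phi))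
              * ov w (Q^t* *m (unitary_mx U *m phi)) ^+ k) =
  (\int[mu]_U (G U * sqn (Q^t* *m (unitary_mx U *m phi)))) / 'C(n + k - 1, k)%:R.
Proof.
move=> QQ bG invG nw.
apply: (@isotropic_moment _ UG R mu n (fun U => Q^t* *m (unitary_mx U *m phi))
  (fun U => G U * sqn (Q^t* *m (unitary_mx U *m phi)))) => //.
- by apply: vmeasurable_mulmx; exact: unitary_vec_measurable.
- by apply: bmM => //; exact: bm_sqn_block.
- by move=> U ->; rewrite mulr0.
- exact: unitary_isotropic.
Qed.

End UnitaryMoments.

(** * Distinct blocks decouple *)

Lemma normalize_vec (R : realType) n (u : 'cV[R[i]]_n) : sqn u != 0 ->
  exists c (v : 'cV[R[i]]_n), [/\ c != 0, u = c *: v, sqn v = 1 & nsq c = sqn u].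
Proof.
move=> u0; have s0 : 0 <= sqn u := sqn_ge0 u.
pose r := Num.sqrt (sqn u).
have rr : r ^+ 2 = sqn u by rewrite sqr_sqrtr.
have r0 : r != 0 by apply: contraNneq u0 => r0; rewrite -rr r0 expr0n.
have rC : r%:C != 0 by rewrite eq_complex /= eqxx andbT.
exists r%:C, (r%:C^-1 *: u); split => //.
- by rewrite scalerA divff // scale1r.
- rewrite -[X in _ = X](divff u0) sqnZ -fmorphV nsqC exprVn rr mulrC //.
- by rewrite nsqC.
Qed.

Lemma vmeasurable_comp d d' (T : measurableType d) (T' : measurableType d')
    (R : realType) n (h : T' -> T) (u : T -> 'cV[R[i]]_n) :
  measurable_fun setT h -> vmeasurable u -> vmeasurable (fun x => u (h x)).
Proof.
by move=> mh mu i; have [m1 m2] := mu i; split;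
  [exact: (measurableT_comp m1 mh)|exact: (measurableT_comp m2 mh)].
Qed.

Lemma norm_Ex_le d (T : measurableType d) (R : realType) (P : probability T R)
    (f g : T -> R) :
  bounded_measurable f -> bounded_measurable g -> (forall x, `|f x| <= g x) ->
  `|\int[P]_x f x| <= \int[P]_x g x.
Proof.
move=> bf bg fg; rewrite ler_norml; apply/andP; split; last first.
  by apply: le_Ex => // x; exact: le_trans (ler_norm _) (fg x).
rewrite lerNl -mulN1r -ExZ //; apply: le_Ex => //; first exact: bmZ.
by move=> x; rewrite mulN1r; apply: le_trans (fg x); rewrite -normrN ler_norm.
Qed.

Lemma dist_exp_le (R : realDomainType) (x y : R) k :
  0 <= x <= 1 -> 0 <= y <= 1 -> `|x ^+ k - y ^+ k| <= k%:R * `|x - y|.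
Proof.
move=> /andP[x0 x1] /andP[y0 y1]; rewrite subrXX normrM mulrC.
apply: ler_wpM2r; first exact: normr_ge0.
apply: le_trans (ler_norm_sum _ _ _) _.
rewrite -[X in _ <= X%:R](card_ord k) -sumr_const; apply: ler_sum => i _.
rewrite ger0_norm ?mulr_ge0 ?exprn_ge0 // -[leRHS]mulr1.
by apply: ler_pM; rewrite ?exprn_ge0 ?exprn_ile1.
Qed.

Section Kernel.
Variables (R : realType) (N : nat).
Local Notation PS := (borel (pure_state R N)).
Variable nu : probability PS R.
Hypothesis hnu : is_haar_state nu.
Local Notation "'D_' k" := ('C(2 ^ N + k - 1, k)%:R : R) (at level 8, k at level 2).

Lemma state_moment_sqn k (u : 'cV[R[i]]_(2 ^ N)) :
  \int[nu]_w (sqn u * ov u (state_vec w) ^+ k) = sqn u / D_ k.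
Proof.
have [u0|u0] := eqVneq (sqn u) 0.
  rewrite u0 mul0r -[RHS](Ex_cst nu); apply: eq_Rintegral => v _.
  by rewrite mul0r.
have [c [v [c0 -> nv _]]] := normalize_vec u0.
rewrite ExZ; last first.
  apply: bmX; apply: bm_ov; first exact: vmeasurable_cst.
  exact: state_vec_measurable.
congr (_ * _); rewrite -(state_moment hnu _ nv); apply: eq_Rintegral => w _.
by rewrite ovZl.
Qed.

Let D_gt0 k : 0 < D_ k.
Proof. by rewrite ltr0n bin_gt0; have := expn_gt0 2 N; lia. Qed.

(* The kernel [D_ l * ov u w ^ l] has integral 1 and concentrates at [w = u]
   when [l] grows. *)
Lemma kernel_approx_unit (u v : 'cV[R[i]]_(2 ^ N)) k l (eta : R) :
  0 < eta -> sqn u = 1 -> sqn v = 1 ->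
  `|\int[nu]_w (D_ l * ov u (state_vec w) ^+ l * ov v (state_vec w) ^+ k)
      - ov u v ^+ k| <= k%:R * (eta + 5 * (2 ^ N)%:R / (eta * l.+1%:R)).
Proof.
move=> eta0 nu1 nv1.
have mw := @state_vec_measurable R N.
have bu a : bounded_measurable (fun w : PS => ov a (state_vec w)).
  by apply: bm_ov => //; exact: vmeasurable_cst.
have bk : bounded_measurable (fun w : PS => D_ l * ov u (state_vec w) ^+ l).
  by apply: bmZ; exact: bmX.
have k1 : \int[nu]_w (D_ l * ov u (state_vec w) ^+ l) = 1.
  rewrite ExZ; last exact: bmX.
  by rewrite (state_moment hnu) // divff // gt_eqF.
have -> : ov u v ^+ k =
    \int[nu]_w (ov u v ^+ k * (D_ l * ov u (state_vec w) ^+ l)).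
  by rewrite ExZ // k1 mulr1.
rewrite -ExB; last 2 first.
- by apply: bmM; [exact: bk|exact: bmX].
- exact: bmZ.
(* For two overlaps [x] and [y], [|x - y| <= eta + (x - y)^2 / (2 eta)], and [ov_lipschitz] bounds
   the square by [10 (1 - o)] with [o = ov u w]. The bound [eta + 5 / eta (1 - o)] is linear in [o],
   so its kernel average involves only the moments of orders [l] and [l + 1]. *)
apply: (@le_trans _ _ (\int[nu]_w (k%:R * ((eta + 5 / eta) * (D_ l * ov u (state_vec w) ^+ l)
   - 5 / eta * D_ l * ov u (state_vec w) ^+ l.+1)))).
  apply: norm_Ex_le.
  - apply: bmB; last exact: bmZ.
    by apply: bmM; [exact: bk|exact: bmX].
  - apply: bmZ; apply: bmB; first exact: bmZ.
    by apply: bmZ; exact: bmX.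
  move=> w; set o := ov u (state_vec w).
  rewrite [_ ^+ k * _]mulrC -mulrBr normrM.
  have o0 : 0 <= o := ov_ge0 _ _.
  have ko : 0 <= D_ l * o ^+ l by rewrite mulr_ge0 ?exprn_ge0 // ltW.
  rewrite (ger0_norm ko) exprS.
  have -> : k%:R * ((eta + 5 / eta) * (D_ l * o ^+ l) - 5 / eta * D_ l * (o * o ^+ l))
    = D_ l * o ^+ l * (k%:R * (eta + 5 / eta * (1 - o))) by ring.
  apply: ler_wpM2l => //.
  apply: le_trans (dist_exp_le _ _ _) _; rewrite ?ov_ge0 ?ov_le1 //.
  apply: ler_wpM2l => //.
  have := ov_lipschitz nu1 nv1 (sqn_state_vec w).
  rewrite (ovC (state_vec w) u) -/o (ovC (state_vec w) v).
  set x := ov v _; set y := ov u v => h.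
  have h2 : (x - y) ^+ 2 / eta <= 5 / eta * (1 - o) * 2.
    rewrite ler_pdivrMr //; apply: le_trans h _.
    rewrite -!mulrA [X in _ <= _ * X](_ : _ = (1 - o) * 2 * (eta^-1 * eta)); last by ring.
    by rewrite mulVf ?gt_eqF //; lra.
  have h3 : `|x - y| <= eta + ((x - y) ^+ 2 / eta) / 2.
    rewrite -real_normK ?num_real //; set z := `|x - y|.
    rewrite -(ler_pM2r eta0) mulrDl mulrAC divfK ?gt_eqF //; nra.
  lra.
rewrite ExZ; last first.
  apply: bmB; first exact: bmZ.
  by apply: bmZ; exact: bmX.
apply: ler_wpM2l => //; rewrite ExB; last 2 first.
- exact: bmZ.
- by apply: bmZ; exact: bmX.
rewrite ExZ // k1 mulr1 ExZ; last exact: bmX.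
rewrite (state_moment hnu) //.
(* Hence the kernel average of [1 - o] is [(d - 1) / (d + l)] with [d = 2 ^ N], which is at most
   [d / (l + 1)]. *)
have dn : (2 ^ N + l)%:R * D_ l = l.+1%:R * D_ l.+1.
  rewrite -!natrM; congr (_%:R).
  have d0 := expn_gt0 2 N.
  rewrite (_ : 2 ^ N + l.+1 - 1 = 2 ^ N + l)%N; last by lia.
  by rewrite -mul_bin_diag -subn1.
have l0 : 0 < l.+1%:R :> R by rewrite ltr0n.
have dl0 : 0 < (2 ^ N + l)%:R :> R by rewrite ltr0n; have := expn_gt0 2 N; lia.
have -> : 5 / eta * D_ l * (D_ l.+1)^-1 = 5 / eta * (l.+1%:R / (2 ^ N + l)%:R).
  rewrite -mulrA; congr (_ * _).
  have -> : D_ l = l.+1%:R * D_ l.+1 / (2 ^ N + l)%:R.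
    by rewrite -dn mulrAC divff ?mul1r // gt_eqF.
  by rewrite mulrAC mulfK // gt_eqF.
rewrite -addrA lerD2l -{1}[5 / eta]mulr1 -mulrBr.
rewrite -mulrA [leRHS](_ : _ = 5 / eta * ((2 ^ N)%:R / l.+1%:R)); last first.
  by rewrite invfM -!mulrA; congr (_ * _); rewrite mulrCA.
apply: ler_wpM2l; first by rewrite divr_ge0 // ltW.
have d1 : 1 <= (2 ^ N)%:R :> R by rewrite ler1n expn_gt0.
have -> : 1 - l.+1%:R / (2 ^ N + l)%:R =
    ((2 ^ N + l)%:R - l.+1%:R) / (2 ^ N + l)%:R :> R.
  by rewrite mulrBl divff // gt_eqF.
rewrite ler_pdivrMr // mulrAC ler_pdivlMr //.
rewrite natrD -natr1; have l1 : 0 <= l%:R :> R by []; nra.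
Qed.

Lemma kernel_approx (u v : 'cV[R[i]]_(2 ^ N)) k l (eta : R) : 0 < eta ->
  `|\int[nu]_w (D_ l * (sqn u * sqn v)
        * (ov u (state_vec w) ^+ l * ov v (state_vec w) ^+ k))
      - sqn u * sqn v * ov u v ^+ k|
  <= sqn u * sqn v * (k%:R * (eta + 5 * (2 ^ N)%:R / (eta * l.+1%:R))).
Proof.
move=> eta0.
have [h0|h0] := eqVneq (sqn u * sqn v) 0.
  rewrite h0 !mul0r subr0; under eq_Rintegral do rewrite mulr0 mul0r.
  by rewrite Ex_cst normr0.
have [u0 v0] : sqn u != 0 /\ sqn v != 0.
  by split; apply: contra h0 => /eqP ->; rewrite ?mul0r ?mulr0.
have [c [u' [c0 uE nu' _]]] := normalize_vec u0.
have [e [v' [e0 vE nv' _]]] := normalize_vec v0.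
have uvE w : D_ l * (sqn u * sqn v) * (ov u (state_vec w) ^+ l * ov v (state_vec w) ^+ k)
  = sqn u * sqn v * (D_ l * ov u' (state_vec w) ^+ l * ov v' (state_vec w) ^+ k).
  rewrite {2}uE {2}vE !ovZl //.
  by rewrite -!mulrA [LHS]mulrCA; congr (_ * _); rewrite [LHS]mulrCA.
under eq_Rintegral do rewrite uvE.
have -> : ov u v = ov u' v' by rewrite uE vE ovZl // ovZr.
rewrite ExZ; last first.
  have mw := @state_vec_measurable R N.
  by apply: bmM; [apply: bmZ|]; apply: bmX; apply: bm_ov => //; exact: vmeasurable_cst.
rewrite -mulrBr normrM ger0_norm ?mulr_ge0 ?sqn_ge0 //.
apply: ler_wpM2l; first by rewrite mulr_ge0 ?sqn_ge0.
exact: kernel_approx_unit.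
Qed.

Section Decorrelation.
Context (d : measure_display) (T : measurableType d).
Variables (P : probability T R) (u v : T -> 'cV[R[i]]_(2 ^ N)) (k : nat).
Hypotheses (mu : vmeasurable u) (mv : vmeasurable v).
Hypotheses (u_le1 : forall x, sqn (u x) <= 1) (v_le1 : forall x, sqn (v x) <= 1).
Hypothesis isou : forall l (w : 'cV[R[i]]_(2 ^ N)), sqn w = 1 ->
  \int[P]_x (sqn (v x) * ov (v x) w ^+ k * sqn (u x) * ov w (u x) ^+ l)
  = (\int[P]_x (sqn (v x) * ov (v x) w ^+ k * sqn (u x))) / D_ l.

Lemma decorrelation :
  \int[P]_x (sqn (u x) * sqn (v x) * ov (u x) (v x) ^+ k) =
  (\int[P]_x (sqn (u x) * sqn (v x))) / D_ k.
Proof.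
have mw := @state_vec_measurable R N.
have bm_sqn_le1 (y : T -> 'cV[R[i]]_(2 ^ N)) : vmeasurable y ->
    (forall x, sqn (y x) <= 1) -> bounded_measurable (fun x => sqn (y x)).
  move=> my y1; split; first exact: measurable_sqn.
  by exists 1 => x; rewrite ger0_norm ?sqn_ge0.
have bu := bm_sqn_le1 u mu u_le1.
have bv := bm_sqn_le1 v mv v_le1.
set X := LHS; set Y := RHS.
pose f l (x : T) (w : PS) := D_ l * (sqn (u x) * sqn (v x))
        * (ov (u x) (state_vec w) ^+ l * ov (v x) (state_vec w) ^+ k).
have bf l : bounded_measurable
    (fun z : T * PS => f l z.1 z.2).
  have mu2 := vmeasurable_comp (@measurable_fst _ _ T PS) mu.
  have mv2 := vmeasurable_comp (@measurable_fst _ _ T PS) mv.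
  have mw2 := vmeasurable_comp (@measurable_snd _ _ T PS) mw.
  apply: bmM; [apply: bmZ|]; apply: bmM.
  - exact: (bm_comp (@measurable_fst _ _ T PS) bu).
  - exact: (bm_comp (@measurable_fst _ _ T PS) bv).
  - exact: (bmX l (bm_ov mu2 mw2)).
  - exact: (bmX k (bm_ov mv2 mw2)).
(* Integrating over [x] first, [isou] produces [1 / D_l], which the prefactor of the kernel cancels.
   Integrating what remains over [w] produces [1 / D_k]. The smeared integral is thus exact for
   every [l]. *)
have SE l : \int[P]_x \int[nu]_w f l x w = Y.
  rewrite (Ex_swap P nu (bf l)).
  transitivity (\int[nu]_w \int[P]_x (sqn (u x) * (sqn (v x) * ov (v x) (state_vec w) ^+ k))).
    apply: eq_Rintegral => w _.
    transitivity (\int[P]_x ((D_ l) * (sqn (v x) * ov (v x) (state_vec w) ^+ k * sqn (u x)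
        * ov (state_vec w) (u x) ^+ l))).
      by apply: eq_Rintegral => x _; rewrite /f (ovC (state_vec w)); ring.
    rewrite ExZ; last first.
      apply: bmM; last by apply: bmX; apply: bm_ov => //; exact: vmeasurable_cst.
      apply: bmM => //; apply: bmM => //.
      by apply: bmX; apply: bm_ov => //; exact: vmeasurable_cst.
    rewrite isou ?sqn_state_vec // mulrC divfK ?gt_eqF //.
    by apply: eq_Rintegral => x _; rewrite mulrC.
  rewrite -(Ex_swap P nu (f := fun x w =>
    sqn (u x) * (sqn (v x) * ov (v x) (state_vec w) ^+ k))); last first.
    have mv2 := vmeasurable_comp (@measurable_fst _ _ T PS) mv.
    have mw2 := vmeasurable_comp (@measurable_snd _ _ T PS) mw.
    apply: bmM; first exact: (bm_comp (@measurable_fst _ _ T PS) bu).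
    apply: bmM; first exact: (bm_comp (@measurable_fst _ _ T PS) bv).
    by apply: bmX; exact: bm_ov.
  rewrite /Y [RHS]mulrC -ExZ; last exact: bmM.
  apply: eq_Rintegral => x _.
  rewrite ExZ; last first.
    by apply: bmZ; apply: bmX; apply: bm_ov => //; exact: vmeasurable_cst.
  by rewrite state_moment_sqn mulrA [LHS]mulrC.
have close l eta : 0 < eta ->
    `|X - Y| <= k%:R * (eta + 5 * (2 ^ N)%:R / (eta * l.+1%:R)).
  move=> eta0; rewrite -(SE l) distrC /X -ExB; last 2 first.
  - exact: bm_Ex2.
  - by apply: bmM; [exact: bmM|apply: bmX; exact: bm_ov].
  rewrite -[leRHS](Ex_cst P); apply: norm_Ex_le.
  - apply: bmB; first exact: bm_Ex2.
    by apply: bmM; [exact: bmM|apply: bmX; exact: bm_ov].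
  - exact: bm_cst.
  move=> x; apply: le_trans (kernel_approx (u x) (v x) k l eta0) _.
  rewrite -[leRHS]mul1r; apply: ler_wpM2r.
    apply: mulr_ge0 => //; apply: addr_ge0; first exact: ltW.
    by apply: divr_ge0; apply: mulr_ge0 => //; exact: ltW.
  by rewrite -[leRHS]mulr1; apply: ler_pM; rewrite ?sqn_ge0.
apply/eqP; rewrite -subr_eq0 -normr_le0 leNgt; apply/negP => x0.
set z := `|X - Y| in close x0.
(* Each of the two error terms is kept to at most [z / 3], whence the 3 here and the [15 = 3 * 5] in
   [B]; [k.+1] in place of [k] keeps the divisor nonzero at [k = 0]. *)
pose eta := z / (3 * k.+1%:R).
have kp : 0 < k.+1%:R :> R by rewrite ltr0n.
have eta0 : 0 < eta by rewrite divr_gt0 // mulr_gt0.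
pose B := 15 * k.+1%:R * (2 ^ N)%:R / (eta * z).
have [l lB] : exists l : nat, B < l.+1%:R.
  exists (Num.truncn B); exact: truncnS_gt.
have := close l eta eta0.
have kk : k%:R <= k.+1%:R :> R by rewrite ler_nat.
have d0 : 0 <= (2 ^ N)%:R :> R by [].
have lp : 0 < l.+1%:R :> R by rewrite ltr0n.
have e1 : k.+1%:R * eta = z / 3.
  by rewrite /eta; field; rewrite gt_eqF.
have e2 : k.+1%:R * (5 * (2 ^ N)%:R / (eta * l.+1%:R)) < z / 3.
  rewrite mulrA ltr_pdivrMr ?mulr_gt0 //.
  move: lB; rewrite /B ltr_pdivrMr ?mulr_gt0 //; lra.
have e3 : 0 <= eta + 5 * (2 ^ N)%:R / (eta * l.+1%:R).
  apply: addr_ge0; first exact: ltW.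
  by apply: divr_ge0; apply: mulr_ge0 => //; exact: ltW.
move=> c; have /(le_trans c) := ler_wpM2r e3 kk.
rewrite mulrDr e1; move: e2; set E := k.+1%:R * _ => e2 c2.
have x3 : z / 3 * 3 = z by rewrite divfK.
move: (z / 3) x3 e2 c2 => y; lra.
Qed.

End Decorrelation.

Variables (m : nat) (mu : probability (borel (unitary_group R m)) R).
Hypothesis hmu : is_haar mu.

Lemma block_decorrelation (Q Q' : 'M[R[i]]_(m, 2 ^ N)) (phi phi' : 'cV_m) k :
  Q^t* *m Q = 1%:M -> Q'^t* *m Q' = 1%:M -> Q'^t* *m Q = 0 ->
  sqn phi = 1 -> sqn phi' = 1 ->
  let u (U : borel (unitary_group R m)) := Q^t* *m (unitary_mx U *m phi) in
  let v (U : borel (unitary_group R m)) := Q'^t* *m (unitary_mx U *m phi') in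
  \int[mu]_U (sqn (u U) * sqn (v U) * ov (u U) (v U) ^+ k) =
  (\int[mu]_U (sqn (u U) * sqn (v U))) / D_ k.
Proof.
move=> QQ QQ' Q'Q n1 n1' u v.
have mu' : vmeasurable u by apply: vmeasurable_mulmx; exact: unitary_vec_measurable.
have mv : vmeasurable v by apply: vmeasurable_mulmx; exact: unitary_vec_measurable.
have u1 U : sqn (u U) <= 1.
  by apply: le_trans (sqn_adj_le _ QQ) _; rewrite sqn_unitary n1.
have v1 U : sqn (v U) <= 1.
  by apply: le_trans (sqn_adj_le _ QQ') _; rewrite sqn_unitary n1'.
pose G w (U : borel (unitary_group R m)) := sqn (v U) * ov (v U) w ^+ k.
have bG w : bounded_measurable (G w).
  apply: bmM; first exact: bm_sqn_block.
  by apply: bmX; apply: bm_ov => //; exact: vmeasurable_cst.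
have invG w V W : V \is unitarymx -> unitary_mx W = block_unitary Q V ->
    forall U, G w (unitary_mul W U) = G w U.
  move=> _ WE U; rewrite /G.
  suff -> : v (unitary_mul W U) = v U by [].
  have -> : v (unitary_mul W U) = Q'^t* *m (unitary_mx W *m unitary_mx U *m phi') by [].
  by rewrite WE /v !mulmxA block_unitary_orth.
have isou l w (nw : sqn w = 1) :=
  @unitary_moment R m mu hmu _ Q phi (G w) l w QQ (bG w) (invG w) nw.
exact: (@decorrelation _ _ mu u v k mu' mv u1 v1 isou).
Qed.

End Kernel.

(** * Two columns in the same block *)

(* With [X] of squared block norm [a], the block of the component of [Y]
   orthogonal to [X] is a linear image of an isometric image [xi] of [Y]: it is
   [xi] shrunk by [c = sqrt (1 - a)] in the direction [e] of the block of [X]. *)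
Lemma orthogonal_block_frame (R : realType) m n (E : 'M[R[i]]_(m, n)) (X : 'cV[R[i]]_m) :
  E^t* *m E = 1%:M -> sqn X = 1 -> sqn (E^t* *m X) != 0 ->
  exists (Q : 'M[R[i]]_(m, n)) (e : 'cV[R[i]]_n) (r c : R),
    [/\ Q^t* *m Q = 1%:M, sqn e = 1, E^t* *m X = r%:C *: e,
        r ^+ 2 = sqn (E^t* *m X) /\ c ^+ 2 = 1 - sqn (E^t* *m X) &
        forall Y, E^t* *m (Y - dot X Y *: X) =
          Q^t* *m Y - ((1 - c)%:C * dot e (Q^t* *m Y)) *: e].
Proof.
move=> EE nX; set x := E^t* *m X; set a := sqn x => a0.
have a_le1 : a <= 1 by rewrite -nX; exact: sqn_adj_le.
have a_ge0 : 0 <= a := sqn_ge0 x.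
pose r := Num.sqrt a; pose c := Num.sqrt (1 - a).
have r2 : r ^+ 2 = a by rewrite sqr_sqrtr.
have c2 : c ^+ 2 = 1 - a by rewrite sqr_sqrtr // subr_ge0.
have r0 : r != 0 by apply: contraNneq a0 => r0; rewrite -r2 r0 expr0n.
have rC : r%:C != 0 by rewrite eq_complex /= eqxx andbT.
have [e [xE ne]] : exists e, x = r%:C *: e /\ sqn e = 1.
  exists ((r%:C)^-1 *: x); split; first by rewrite scalerA divff // scale1r.
  by rewrite sqnZ -fmorphV nsqC exprVn r2 mulVf.
(* [Q] will agree with [E] except that [e] is sent to the unit vector along the component of
   [E *m e] orthogonal to [X]; [g] is the correction. The first two properties make [Q] an isometry,
   the third compares the blocks. *)
have [g [gam [gg Eg gY]]] : exists (g : 'cV[R[i]]_m) (gam : R),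
    [/\ sqn g = - 2 * gam, E^t* *m g = gam%:C *: e &
      g + r%:C *: X = (1 - c)%:C *: (E *m e + g)].
  have dEe : dot (E *m e) X = r%:C.
    by rewrite dotJ dot_mulr -/x xE dotZl dotuu ne; apply: complexP; rewrite !ReImE /=; ring.
  (* If [c = 0], then [X = E *m e] lies inside the block and there is no such orthogonal component;
     [Q = E] serves. *)
  have [c0|c0] := eqVneq c 0.
    exists 0, 0; rewrite sqn0 mulr0 mulmx0 scale0r c0 subr0 scale1r add0r addr0.
    have a1 : a = 1 by move: c2; rewrite c0 expr0n /=; lra.
    have r1 : r = 1 by rewrite /r a1 sqrtr1.
    split => //; rewrite r1 scale1r; apply/eqP; rewrite -subr_eq0; apply/eqP/sqn_eq0.
    rewrite sqnB isometry_sqn // ne nX dotJ dEe r1 conjCE /=; lra.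
  have cC : c%:C != 0 by rewrite eq_complex /= eqxx andbT.
  pose m0 := (c%:C)^-1 *: (E *m e - r%:C *: X).
  have m0E : c%:C *: m0 = E *m e - r%:C *: X by rewrite scalerA divff // scale1r.
  have nm0 : sqn m0 = 1.
    rewrite sqnZ -fmorphV nsqC sqnB sqnZ isometry_sqn // ne nX nsqC dotZr dEe !ReImE /=.
    by rewrite exprVn c2 -r2; field; rewrite r2 -c2 sqrf_eq0.
  have Em0 : E^t* *m m0 = c%:C *: e.
    rewrite -scalemxAr mulmxBr mulmxA EE mul1mx -scalemxAr -/x xE scalerA.
    rewrite -[X in X - _]scale1r -scalerBl scalerA; congr (_ *: _).
    rewrite -rmorphM -expr2 r2 -(rmorph1 (real_complex R)) -rmorphB -c2 rmorphXn.
    by rewrite expr2 mulKf.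
  exists (m0 - E *m e), (c - 1); split.
  - rewrite sqnB nm0 isometry_sqn // ne dot_mulr.
    by rewrite Em0 dotZl dotuu ne !ReImE /=; ring.
  - by rewrite mulmxBr Em0 mulmxA EE mul1mx rmorphB /= scalerBl scale1r.
  - rewrite [E *m e + _]addrC subrK rmorphB scalerBl m0E /= scale1r.
    by rewrite opprB addrA [RHS]addrAC.
pose Q := E + g *m e^t*.
have QE Y : Q^t* *m Y = E^t* *m Y + dot g Y *: e.
  rewrite /Q linearD /= map_mxD mulmxDl; congr (_ + _).
  rewrite trmx_mul map_mxM /= trmxCK -mulmxA [g^t* *m Y]mx11_scalar.
  by rewrite mul_mx_scalar.
exists Q, e, r, c; split => //.
- apply: mx_colP => w; rewrite mul1mx -mulmxA QE.
  have -> : Q *m w = E *m w + dot e w *: g.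
    rewrite /Q mulmxDl; congr (_ + _).
    by rewrite -mulmxA [e^t* *m w]mx11_scalar mul_mx_scalar.
  rewrite mulmxDr mulmxA EE mul1mx -scalemxAr Eg dotDr dot_mulr Eg dotZl dotZr dotuu gg.
  rewrite scalerA -addrA -scalerDl [X in X *: e](_ : _ = 0) ?scale0r ?addr0 //.
  by apply: complexP; rewrite !ReImE /=; ring.
move=> Y; rewrite QE mulmxBr -scalemxAr -/x xE scalerA -addrA; congr (_ + _).
have := congr1 (fun z => dot z Y) gY.
rewrite /= !dotDl !dotZl dotDl.
rewrite (conjCE r%:C) (conjCE (1 - c)%:C) /= oppr0 dotDr dotZr dotuu ne mulr1.
have <- : dot e (E^t* *m Y) = dot (E *m e) Y by rewrite dot_mulr trmxCK.
move=> h; rewrite -scaleNr -scalerBl; congr (_ *: _).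
have -> : (1 - c)%:C * (dot e (E^t* *m Y) + dot g Y) = dot g Y + r%:C * dot X Y.
  by rewrite [RHS]h.
by ring.
Qed.

(** * Moments of a single Haar column *)

Section ColumnMoments.
Variables (R : realType) (m : nat) (mu : probability (borel (unitary_group R m)) R).
Local Notation UG := (borel (unitary_group R m)).
Hypothesis hmu : is_haar mu.
Variable phi : 'cV[R[i]]_m.
Hypothesis nphi : sqn phi = 1.

Let isotropic_column k (a b : 'cV[R[i]]_m) : sqn a = 1 -> sqn b = 1 ->
  \int[mu]_U (1 * ov a (unitary_mx U *m phi) ^+ k)
  = \int[mu]_U (1 * ov b (unitary_mx U *m phi) ^+ k).
Proof.
move=> na nb; have [V [Vu Vab _]] := householder nb na.
have [W WE] := unitary_of_mx Vu.
have bf : bounded_measurable (fun U : UG => 1 * ov a (unitary_mx U *m phi) ^+ k).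
  apply: bmZ; apply: bmX; apply: bm_ov; first exact: vmeasurable_cst.
  exact: unitary_vec_measurable.
rewrite -(haar_Ex_mull hmu W bf); apply: eq_Rintegral => U _.
have -> : unitary_mx (unitary_mul W U) *m phi = V *m (unitary_mx U *m phi).
  by rewrite mulmxA -WE.
by rewrite -Vab ov_isometry //; exact: unitarymxC.
Qed.

Lemma column_moment k w : sqn w = 1 ->
  \int[mu]_U ov w (unitary_mx U *m phi) ^+ k = ('C(m + k - 1, k)%:R)^-1.
Proof.
move=> nw.
transitivity (\int[mu]_U (1 * ov w (unitary_mx U *m phi) ^+ k)).
  by apply: eq_Rintegral => U _; rewrite mul1r.
rewrite (@isotropic_moment _ UG R mu m (fun U => unitary_mx U *m phi) (fun=> 1)
  (unitary_vec_measurable phi) (bm_cst _ 1)) ?Ex_cst ?div1r //.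
by move=> U; rewrite sqn_unitary nphi => /eqP; rewrite oner_eq0.
Qed.

Lemma column_moment_mixed i j : i != j ->
  \int[mu]_U (ov (delta_mx i 0) (unitary_mx U *m phi)
              * ov (delta_mx j 0) (unitary_mx U *m phi))
  = (2 * 'C(m + 1, 2)%:R)^-1.
Proof.
move=> ij.
have := @isotropic_mixed _ UG R mu m (fun U => unitary_mx U *m phi) (fun=> 1)
  (unitary_vec_measurable phi) (bm_cst _ 1) isotropic_column i j 1 ij.
have -> : \int[mu]_U (1 * ov (delta_mx i 0) (unitary_mx U *m phi) ^+ 2)
  = ('C(m + 1, 2)%:R)^-1.
  rewrite (_ : m + 1 = m + 2 - 1)%N; last by lia.
  rewrite -(column_moment 2 (sqn_delta R i)).
  by apply: eq_Rintegral => U _; rewrite mul1r.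
under eq_Rintegral do rewrite mul1r expr1.
by move=> /(congr1 (fun x => 2^-1 * x)); rewrite mulKf ?pnatr_eq0 // invfM.
Qed.

Lemma block_sqn_moment1 n (Q : 'M[R[i]]_(m, n)) : Q^t* *m Q = 1%:M ->
  \int[mu]_U sqn (Q^t* *m (unitary_mx U *m phi)) = n%:R / m%:R.
Proof.
move=> QQ.
transitivity (\int[mu]_U (\sum_(a < n)
    ov (Q *m delta_mx a 0) (unitary_mx U *m phi) ^+ 1)).
  apply: eq_Rintegral => U _; rewrite {1}/sqn; apply: eq_bigr => a _.
  rewrite -dot_deltal dot_mulr trmxCK /ov isometry_sqn // sqn_delta sqn_unitary nphi.
  by rewrite mulr1 divr1.
rewrite Ex_sum; last first.
  move=> a; apply: bmX; apply: bm_ov; first exact: vmeasurable_cst.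
  exact: unitary_vec_measurable.
rewrite (eq_bigr (fun=> m%:R^-1)); last first.
  by move=> a _; rewrite column_moment ?isometry_sqn ?sqn_delta // addnK bin1.
by rewrite sumr_const card_ord mulr_natl.
Qed.

(** The squared moduli [t_i] of the entries satisfy [E t_i^2 = 2 / (m (m + 1))] and
    [E t_i t_j = 1 / (m (m + 1))]; the square of the block sum has [n] terms of the first kind and
    [n (n - 1)] of the second. *)
Lemma block_sqn_moment2 n (f : 'I_n -> 'I_m) : injective f ->
  \int[mu]_U (\sum_a nsq ((unitary_mx U *m phi) (f a) 0)) ^+ 2
  = n%:R * (n%:R + 1) / (m%:R * (m%:R + 1)).
Proof.
move=> finj.
pose t (U : UG) i := ov (delta_mx i 0) (unitary_mx U *m phi).
have tE U i : nsq ((unitary_mx U *m phi) i 0) = t U i.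
  by rewrite /t /ov sqn_delta sqn_unitary nphi mulr1 divr1 dot_deltal.
have bt i : bounded_measurable (fun U => t U i).
  by apply: bm_ov; [exact: vmeasurable_cst|exact: unitary_vec_measurable].
transitivity (\int[mu]_U (\sum_a \sum_b t U (f a) * t U (f b))).
  apply: eq_Rintegral => U _; rewrite expr2 mulr_suml; apply: eq_bigr => a _.
  by rewrite mulr_sumr; apply: eq_bigr => b _; rewrite !tE.
rewrite Ex_sum; last by move=> a; apply: bm_sum => b; exact: bmM.
have C2 : 2 * 'C(m + 1, 2)%:R = m%:R * (m%:R + 1) :> R.
  by rewrite addn1 -natrM -(mul_bin_diag m.+1 1) bin1 natrM mulrC natr1.
transitivity (\sum_(a < n) (n%:R + 1) * (m%:R * (m%:R + 1))^-1 : R).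
  apply: eq_bigr => a _; rewrite Ex_sum; last by move=> b; exact: bmM.
  rewrite (bigD1 a) //= (eq_bigr (fun=> (m%:R * (m%:R + 1))^-1)); last first.
    move=> b ba; rewrite column_moment_mixed ?C2 //.
    by apply: contra ba => /eqP /finj ->.
  have -> : \int[mu]_U (t U (f a) * t U (f a)) = 2 * (m%:R * (m%:R + 1))^-1.
    under eq_Rintegral do rewrite -expr2.
    rewrite /t column_moment ?sqn_delta // (_ : m + 2 - 1 = m + 1)%N; last by lia.
    by rewrite -C2 invfM mulVKf ?pnatr_eq0.
  rewrite sumr_const cardC1 card_ord -[X in _ + X]mulr_natl -mulrDl; congr (_ * _).
  have n0 : (0 < n)%N by case: (n) a => // -[].
  rewrite -subn1 natrB //; ring.
by rewrite sumr_const card_ord -[LHS]mulr_natl mulrA.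
Qed.

End ColumnMoments.

(** * Correlation of two orthogonal columns inside one block *)

Definition perp (R : realType) n (X Y : 'cV[R[i]]_n) := Y - dot X Y *: X.

Lemma sqn_perp (R : realType) n (X Y : 'cV[R[i]]_n) : sqn X = 1 ->
  sqn (perp X Y) = sqn Y - nsq (dot X Y).
Proof.
move=> nX; rewrite /perp sqnB sqnZ nX mulr1 dotZr (dotJ X Y) /nsq !ReImE; ring.
Qed.

Lemma dot_perp (R : realType) n (X Y : 'cV[R[i]]_n) : sqn X = 1 ->
  dot X (perp X Y) = 0.
Proof. by move=> nX; rewrite /perp dotBr dotZr dotuu nX mulr1 subrr. Qed.

Lemma mulmx_perp (R : realType) n (U : 'M[R[i]]_n) X Y : U \is unitarymx ->
  U *m perp X Y = perp (U *m X) (U *m Y).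
Proof.
move=> Uu; rewrite /perp mulmxBr -scalemxAr isometry_dot //; exact: unitarymxC.
Qed.

Lemma vmeasurable_mulmx2 d (T : measurableType d) (R : realType) m n
    (A : T -> 'M[R[i]]_(m, n)) (xi : T -> 'cV_n) :
  (forall i j, cmeasurable (fun x => A x i j)) -> vmeasurable xi ->
  vmeasurable (fun x => A x *m xi x).
Proof.
move=> mA mxi i; under eq_fun do rewrite mxE.
by apply: cmeasurable_sum => j; exact: cmeasurableM.
Qed.

Lemma vmeasurable_perp d (T : measurableType d) (R : realType) n
    (X Y : T -> 'cV[R[i]]_n) :
  vmeasurable X -> vmeasurable Y -> vmeasurable (fun t => perp (X t) (Y t)).
Proof.
move=> mX mY; apply: vmeasurableD => //.
have -> : (fun t => - (dot (X t) (Y t) *: X t)) =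
          (fun t => (-1 * dot (X t) (Y t)) *: X t).
  by apply/funext => t; rewrite mulN1r scaleNr.
apply: vmeasurableZ => //; apply: cmeasurableM; first exact: cmeasurable_cst.
exact: cmeasurable_dot.
Qed.

Lemma cmeasurable_comp d d' (T : measurableType d) (T' : measurableType d')
    (R : realType) (h : T' -> T) (u : T -> R[i]) :
  measurable_fun setT h -> cmeasurable u -> cmeasurable (fun x => u (h x)).
Proof.
by move=> mh [m1 m2]; split; [exact: (measurableT_comp m1 mh)|exact: (measurableT_comp m2 mh)].
Qed.

Section BlockOverlap.
Variables (R : realType) (m n : nat) (E : 'M[R[i]]_(m, n)) (k : nat).
Hypothesis EE : E^t* *m E = 1%:M.

Definition block_overlap (x y : 'cV[R[i]]_m) : R :=
  sqn (E^t* *m x) * sqn (E^t* *m y) * ov (E^t* *m x) (E^t* *m y) ^+ k.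

Lemma block_overlap_ge0 x y : 0 <= block_overlap x y.
Proof. by rewrite !mulr_ge0 ?sqn_ge0 ?exprn_ge0 ?ov_ge0. Qed.

Lemma block_overlap_le x y : block_overlap x y <= sqn x * sqn y.
Proof.
rewrite -[leRHS]mulr1; apply: ler_pM; rewrite ?mulr_ge0 ?sqn_ge0 ?exprn_ge0 ?ov_ge0 //.
  by apply: ler_pM; rewrite ?sqn_ge0 ?sqn_adj_le.
by apply: exprn_ile1; rewrite ?ov_ge0 ?ov_le1.
Qed.

Lemma block_overlapZr c x y : block_overlap x (c *: y) = nsq c * block_overlap x y.
Proof.
have [->|c0] := eqVneq c 0.
  by rewrite scale0r nsq0 mul0r /block_overlap mulmx0 sqn0 mulr0 mul0r.
by rewrite /block_overlap -scalemxAr sqnZ ovZr // mulrCA !mulrA.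
Qed.

Lemma bm_block_overlap d (T : measurableType d) (x y : T -> 'cV[R[i]]_m) :
  vmeasurable x -> vmeasurable y ->
  (forall t, sqn (x t) <= 1) -> (forall t, sqn (y t) <= 1) ->
  bounded_measurable (fun t => block_overlap (x t) (y t)).
Proof.
move=> mx my x1 y1; split.
  have mEx : vmeasurable (fun t => E^t* *m x t) by exact: vmeasurable_mulmx.
  have mEy : vmeasurable (fun t => E^t* *m y t) by exact: vmeasurable_mulmx.
  apply: measurable_funM; last by apply: measurable_funX; exact: (bm_ov mEx mEy).1.
  by apply: measurable_funM; exact: measurable_sqn.
exists 1 => t; rewrite ger0_norm ?block_overlap_ge0 //.
apply: le_trans (block_overlap_le _ _) _.
by rewrite -[leRHS]mulr1; apply: ler_pM; rewrite ?sqn_ge0.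
Qed.

Lemma Ex_swap_overlap d1 d2 (T1 : measurableType d1) (T2 : measurableType d2)
    (P1 : probability T1 R) (P2 : probability T2 R)
    (A : T2 -> 'M[R[i]]_m) (x : T2 -> 'cV[R[i]]_m) (y : T1 -> 'cV[R[i]]_m) :
  (forall i j, cmeasurable (fun t => A t i j)) -> vmeasurable x -> vmeasurable y ->
  (forall t, sqn (x t) <= 1) -> (forall s t, sqn (A t *m y s) <= 1) ->
  \int[P1]_s \int[P2]_t block_overlap (x t) (A t *m y s) =
  \int[P2]_t \int[P1]_s block_overlap (x t) (A t *m y s).
Proof.
move=> mA mx my x1 y1.
have m1 := @measurable_fst _ _ T1 T2; have m2 := @measurable_snd _ _ T1 T2.
apply: (Ex_swap P1 P2 (f := fun s t => block_overlap (x t) (A t *m y s))).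
apply: bm_block_overlap => //.
- exact: (vmeasurable_comp m2 mx).
- apply: (vmeasurable_mulmx2 (A := fun z : T1 * T2 => A z.2)
    (xi := fun z => y z.1)); last exact: (vmeasurable_comp m1 my).
  by move=> i j; exact: (cmeasurable_comp m2 (mA i j)).
Qed.

End BlockOverlap.

Section ColumnPair.
Variables (R : realType) (m : nat) (mu : probability (borel (unitary_group R m)) R).
Local Notation UG := (borel (unitary_group R m)).
Hypothesis hmu : is_haar mu.
Variables (n : nat) (E : 'M[R[i]]_(m, n)).
Hypothesis EE : E^t* *m E = 1%:M.
Variables phi psi : 'cV[R[i]]_m.
Hypotheses (nphi : sqn phi = 1) (npsi : sqn psi = 1) (phipsi : dot phi psi = 0).

Local Notation col U x := (unitary_mx U *m x).

(* The second column of [U] may be replaced by the component, orthogonal to the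
   first one, of a column of an independent Haar unitary. *)
Lemma column_swap k :
  (1 - m%:R^-1) * \int[mu]_U block_overlap E k (col U phi) (col U psi)
  = \int[mu]_U \int[mu]_W block_overlap E k (col U phi) (perp (col U phi) (col W psi)).
Proof.
pose I := \int[mu]_U block_overlap E k (col U phi) (col U psi).
transitivity ((1 - m%:R^-1) * I); first by [].
pose y (W : UG) := perp phi (col W psi).
have my : vmeasurable y.
  by apply: vmeasurable_perp; [exact: vmeasurable_cst|exact: unitary_vec_measurable].
have ny W : sqn (y W) = 1 - ov phi (col W psi) ^+ 1.
  by rewrite /y sqn_perp // sqn_unitary npsi /ov nphi sqn_unitary npsi mulr1 divr1.
have ny1 W : sqn (y W) <= 1 by rewrite ny gerBl exprn_ge0 ?ov_ge0.
have bI : bounded_measurable (fun U : UG => block_overlap E k (col U phi) (col U psi)).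
  apply: (@bm_block_overlap R m n E k EE _ UG (fun U => col U phi) (fun U => col U psi));
    try exact: unitary_vec_measurable.
    by move=> U; rewrite sqn_unitary nphi.
  by move=> U; rewrite sqn_unitary npsi.
(* For fixed [W], [y W] is orthogonal to [phi], so some unitary fixes [phi] and sends [psi] to the
   direction of [y W]; right invariance absorbs it. The length of [y W] comes out by homogeneity. *)
have fixedW W : \int[mu]_U block_overlap E k (col U phi) (col U (y W)) = sqn (y W) * I.
  have [y0|y0] := eqVneq (sqn (y W)) 0.
    rewrite y0 mul0r -[RHS](Ex_cst mu); apply: eq_Rintegral => U _.
    by rewrite (sqn_eq0 y0) mulmx0 -(scale0r 0) block_overlapZr nsq0 mul0r.
  have [c [y' [c0 yE ny' nc]]] := normalize_vec y0.
  have dy' : dot phi y' = 0.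
    apply: (mulfI c0); rewrite -dotZr -yE mulr0; exact: dot_perp.
  have [V [Vu Vpsi Vfix]] := householder npsi ny'.
  have Vphi : V *m phi = phi.
    by apply: Vfix; rewrite dotJ phipsi [RHS]dotJ dy'.
  have [V' VE] := unitary_of_mx Vu.
  transitivity (\int[mu]_U (nsq c * block_overlap E k
      (col (unitary_mul U V') phi) (col (unitary_mul U V') psi))); last first.
    rewrite -nc /I -(haar_Ex_mulr hmu V' bI).
    exact: (ExZ mu (nsq c) (bm_comp (unitary_mulr_measurable V') bI)).
  apply: eq_Rintegral => U _.
  have colV x : col (unitary_mul U V') x = unitary_mx U *m (V *m x).
    by rewrite mulmxA -VE.
  by rewrite !colV Vphi Vpsi yE -scalemxAr block_overlapZr.
have mcol x : vmeasurable (fun U : UG => col U x) := unitary_vec_measurable x.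
transitivity (\int[mu]_W \int[mu]_U block_overlap E k (col U phi) (col U (y W))).
  under [RHS]eq_Rintegral do rewrite fixedW mulrC.
  rewrite ExZ; last first.
    split; first exact: measurable_sqn.
    by exists 1 => W; rewrite ger0_norm ?sqn_ge0.
  rewrite mulrC; congr (_ * _); under eq_Rintegral do rewrite ny.
  rewrite ExB; [|exact: bm_cst|].
    by rewrite Ex_cst (column_moment hmu npsi 1 nphi) addnK bin1.
  by apply: bmX; apply: bm_ov; [exact: vmeasurable_cst|exact: mcol].
have mA i j : cmeasurable (fun U : UG => unitary_mx U i j).
  exact: unitary_entry_measurable.
have x1 U : sqn (col U phi) <= 1 by rewrite sqn_unitary nphi.
have y1 W U : sqn (unitary_mx U *m y W) <= 1 by rewrite sqn_unitary.
transitivity (\int[mu]_U \int[mu]_W block_overlap E k (col U phi) (col U (y W))).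
  exact: (@Ex_swap_overlap R m n E k EE _ _ UG UG mu mu (fun U => unitary_mx U)
    (fun U => col U phi) y mA (mcol phi) my x1 y1).
apply: eq_Rintegral => U _.
have bU : bounded_measurable
    (fun W : UG => block_overlap E k (col U phi) (perp (col U phi) (col W psi))).
  apply: (@bm_block_overlap R m n E k EE _ UG (fun=> col U phi)
    (fun W => perp (col U phi) (col W psi))).
  - exact: vmeasurable_cst.
  - by apply: vmeasurable_perp; [exact: vmeasurable_cst|exact: mcol].
  - by move=> W; rewrite sqn_unitary nphi.
  - move=> W; rewrite sqn_perp ?sqn_unitary ?nphi ?npsi //.
    by rewrite gerBl nsq_ge0.
(* Applying [U] to [y W] amounts to replacing [W] by the product of [U] and [W]; left invariance in
   [W] then removes [U] from the second column. *)
transitivity (\int[mu]_W block_overlap E k (col U phi)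
    (perp (col U phi) (col (unitary_mul U W) psi))).
  apply: eq_Rintegral => W _.
  rewrite /y mulmx_perp; last exact: unitary_mxP.
  by rewrite mulmxA.
exact: (haar_Ex_mull hmu U bU).
Qed.

(** For a vector of squared norm [s] and overlap [o] with [e], shrinking by [sqrt (1 - a)] along [e]
    turns these into [s * (1 - a * o)] and [q]. The bounds come from [(1 - a) * o <= q <= o] and
    [1 - a <= 1 - a * o <= 1]; the exponent [k.+1] collects [k] factors from [q] and one from the
    norm. *)
Lemma shrunk_overlap_bounds (a s o : R) k :
  0 <= a -> a <= 1 -> 0 <= s -> 0 <= o -> o <= 1 ->
  let q := (1 - a) * o / (1 - a * o) in
  a * (1 - a) ^+ k.+1 * (s * o ^+ k) <= a * (s * (1 - a * o)) * q ^+ k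
  /\ a * (s * (1 - a * o)) * q ^+ k <= a * (s * o ^+ k).
Proof.
move=> a0 a1 s0 o0 o1 q.
have r0 : 0 <= 1 - a * o by nra.
have a10 : 0 <= 1 - a by lra.
have [re|rn] := eqVneq (1 - a * o) 0.
  rewrite re !mulr0 mul0r; split; last by rewrite !mulr_ge0 ?exprn_ge0.
  have -> : a = 1 by nra.
  by rewrite subrr expr0n /= mulr0 mul0r.
have rp : 0 < 1 - a * o by rewrite lt_neqAle eq_sym rn.
have q0 : 0 <= q by rewrite divr_ge0 ?mulr_ge0.
have o10 : 0 <= 1 - o by lra.
have qo : q <= o.
  rewrite ler_pdivrMr //; have := mulr_ge0 (mulr_ge0 a0 o0) o10; lra.
have qa : (1 - a) * o <= q.
  rewrite ler_pdivlMr //; have := mulr_ge0 (mulr_ge0 a10 o0) (mulr_ge0 a0 o0); lra.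
have h1 : q ^+ k <= o ^+ k by apply: lerXn2r.
have h2 : ((1 - a) * o) ^+ k <= q ^+ k by apply: lerXn2r => //; exact: mulr_ge0.
rewrite exprMn in h2; split.
  have -> : a * (1 - a) ^+ k.+1 * (s * o ^+ k) =
    a * (s * (1 - a)) * ((1 - a) ^+ k * o ^+ k) by rewrite exprS; ring.
  apply: ler_pM => //; rewrite ?mulr_ge0 ?exprn_ge0 //.
  apply: ler_wpM2l => //; apply: ler_wpM2l => //; nra.
rewrite -mulrA; apply: ler_wpM2l => //; rewrite -mulrA; apply: ler_wpM2l => //.
rewrite -[leRHS]mul1r; apply: ler_pM => //; [exact: exprn_ge0|nra].
Qed.

Let Dk k : R := 'C(n + k - 1, k)%:R.

(** In the frame of [orthogonal_block_frame], the integrand depends only on the norm and the overlap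
    with [e] of the isotropic vector [Q^t* *m col W psi]. The pointwise bounds of
    [shrunk_overlap_bounds] reduce its mean to that of [s * o ^+ k], which [unitary_moment]
    gives. *)
Lemma perp_overlap_bounds k (X : 'cV[R[i]]_m) : sqn X = 1 -> (0 < n)%N ->
  let a := sqn (E^t* *m X) in
  let J := \int[mu]_W block_overlap E k X (perp X (col W psi)) in
  a * (1 - a) ^+ k.+1 * (n%:R / m%:R / Dk k) <= J /\ J <= a * (n%:R / m%:R / Dk k).
Proof.
move=> nX n0 a J.
have [a0|a0] := eqVneq a 0.
  have -> : J = 0.
    rewrite -[RHS](Ex_cst mu); apply: eq_Rintegral => W _.
    by rewrite /block_overlap -/a a0 !mul0r.
  by rewrite a0 !mul0r.
have [Q [e [r [c [QQ ne xE [r2 c2] ZE]]]]] := orthogonal_block_frame EE nX a0.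
rewrite -/a in r2 c2.
have mxi : vmeasurable (fun W : UG => Q^t* *m col W psi).
  by apply: vmeasurable_mulmx; exact: unitary_vec_measurable.
have bs := @bm_sqn_block R m n Q psi QQ.
have bo : bounded_measurable (fun W : UG => sqn (Q^t* *m col W psi)
    * ov e (Q^t* *m col W psi) ^+ k).
  by apply: bmM => //; apply: bmX; apply: bm_ov => //; exact: vmeasurable_cst.
have mean : \int[mu]_W (sqn (Q^t* *m col W psi) * ov e (Q^t* *m col W psi) ^+ k)
    = n%:R / m%:R / Dk k.
  transitivity (\int[mu]_W (1 * sqn (Q^t* *m col W psi) * ov e (Q^t* *m col W psi) ^+ k)).
    by apply: eq_Rintegral => W _; rewrite mul1r.
  rewrite (@unitary_moment R m mu hmu n Q psi (fun=> 1) k e QQ (bm_cst _ 1) _ ne) //.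
  rewrite -(block_sqn_moment1 hmu npsi QQ); congr (_ / _).
  by apply: eq_Rintegral => W _; rewrite mul1r.
have pointwise W : let s := sqn (Q^t* *m col W psi) in
    let o := ov e (Q^t* *m col W psi) in
    block_overlap E k X (perp X (col W psi)) =
    a * (s * (1 - a * o)) * ((1 - a) * o / (1 - a * o)) ^+ k.
  move=> s o; rewrite /block_overlap -/a /perp ZE.
  set xi := Q^t* *m col W psi; set h := dot e xi.
  have hE : s * o = nsq h by rewrite -(ov_mul e xi) ne mul1r.
  have sZ : sqn (xi - ((1 - c)%:C * h) *: e) = s * (1 - a * o).
    rewrite sqnB sqnZ ne mulr1 nsqM nsqC dotZr (dotJ e xi) -/h mulrBr mulr1.
    rewrite (mulrCA s) hE -/s.
    have -> : a = 1 - c ^+ 2 by rewrite c2; ring.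
    rewrite /nsq !ReImE /=; ring.
  have dZ : nsq (dot (E^t* *m X) (xi - ((1 - c)%:C * h) *: e)) = a * (1 - a) * (s * o).
    rewrite xE dotZl nsqM nsqJ nsqC r2 dotBr dotZr dotuu ne mulr1 -/h.
    rewrite -mulrA; congr (_ * _).
    have -> : h - (1 - c)%:C * h = c%:C * h.
      by apply: complexP; rewrite !ReImE /=; ring.
    by rewrite nsqM nsqC c2 hE.
  rewrite sZ; have [s0|s0] := eqVneq s 0; first by rewrite s0 !mul0r !mulr0 !mul0r.
  congr (_ * _ ^+ _).
  have -> : ov (E^t* *m X) (xi - ((1 - c)%:C * h) *: e) =
      a * (1 - a) * (s * o) / (a * (s * (1 - a * o))) by rewrite {1}/ov dZ sZ.
  (* When [1 - a * o = 0] both quotients have denominator 0 and hence value 0. *)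
  have [ao|ao] := eqVneq (1 - a * o) 0; first by rewrite ao !mulr0 !invr0 !mulr0.
  by move: ao; clearbody s o => ao; field; rewrite a0 s0 ao.
have a_ge0 : 0 <= a := sqn_ge0 _.
have a_le1 : a <= 1 by rewrite -nX; exact: sqn_adj_le.
have bJ : bounded_measurable (fun W : UG => block_overlap E k X (perp X (col W psi))).
  apply: (@bm_block_overlap R m n E k EE _ UG (fun=> X)
    (fun W => perp X (col W psi))).
  - exact: vmeasurable_cst.
  - apply: vmeasurable_perp; first exact: vmeasurable_cst.
    exact: unitary_vec_measurable.
  - by move=> W; rewrite nX.
  - by move=> W; rewrite sqn_perp // sqn_unitary npsi gerBl nsq_ge0.
have bounds W := shrunk_overlap_bounds k a_ge0 a_le1
  (sqn_ge0 (Q^t* *m col W psi)) (ov_ge0 e (Q^t* *m col W psi))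
  (ov_le1 e (Q^t* *m col W psi)).
have lb W : a * (1 - a) ^+ k.+1 *
    (sqn (Q^t* *m col W psi) * ov e (Q^t* *m col W psi) ^+ k) <=
    block_overlap E k X (perp X (col W psi)).
  by rewrite pointwise; exact: (bounds W).1.
have ub W : block_overlap E k X (perp X (col W psi)) <=
    a * (sqn (Q^t* *m col W psi) * ov e (Q^t* *m col W psi) ^+ k).
  by rewrite pointwise; exact: (bounds W).2.
have meanZ z : \int[mu]_W (z * (sqn (Q^t* *m col W psi) * ov e (Q^t* *m col W psi) ^+ k))
    = z * (n%:R / m%:R / Dk k) by rewrite -mean; exact: (ExZ mu z bo).
split.
  exact: (eq_ind _ (fun z => z <= J) (le_Ex mu (bmZ _ bo) bJ lb) _ (meanZ _)).
exact: (eq_ind _ (fun z => J <= z) (le_Ex mu bJ (bmZ _ bo) ub) _ (meanZ _)).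
Qed.

End ColumnPair.

(** * The Hilbert-Schmidt inner product *)

Section HilbertSchmidt.
Variable R : realType.

Definition hsdot m n (A B : 'M[R[i]]_(m, n)) : R[i] :=
  \sum_i \sum_j A i j * ((B i j)^*)%R.

(** The real pairing yields the squared norm and commutes with real integrals; the complex [hsdot]
    accompanies it because that one is multiplicative on tensor products. *)
Definition rdot m n (A B : 'M[R[i]]_(m, n)) : R :=
  \sum_i \sum_j (Re (A i j) * Re (B i j) + Im (A i j) * Im (B i j)).

Lemma rdotE m n (A B : 'M[R[i]]_(m, n)) : rdot A B = Re (hsdot A B).
Proof.
rewrite Re_sum; apply: eq_bigr => i _; rewrite Re_sum; apply: eq_bigr => j _.
by rewrite !ReImE mulrN opprK.
Qed.

Lemma rdotC m n (A B : 'M[R[i]]_(m, n)) : rdot A B = rdot B A.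
Proof.
by apply: eq_bigr => i _; apply: eq_bigr => j _; rewrite mulrC [Im _ * _]mulrC.
Qed.

Lemma rdotDl m n (A B D : 'M[R[i]]_(m, n)) : rdot (A + B) D = rdot A D + rdot B D.
Proof.
rewrite /rdot -big_split; apply: eq_bigr => i _ /=; rewrite -big_split.
by apply: eq_bigr => j _ /=; rewrite mxE !ReImE; ring.
Qed.

Lemma rdotZl m n (c : R) (A D : 'M[R[i]]_(m, n)) : rdot (c%:C *: A) D = c * rdot A D.
Proof.
rewrite /rdot mulr_sumr; apply: eq_bigr => i _; rewrite mulr_sumr.
by apply: eq_bigr => j _ /=; rewrite mxE !ReImE /=; ring.
Qed.

Lemma rdot_suml m n (I : Type) (s : seq I) (P : pred I) (F : I -> 'M[R[i]]_(m, n)) D :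
  rdot (\sum_(i <- s | P i) F i) D = \sum_(i <- s | P i) rdot (F i) D.
Proof.
apply: (big_morph (fun A => rdot A D)) => [A B|]; first exact: rdotDl.
by rewrite -(scale0r 0) -[0 : R[i]]/(0%:C) rdotZl mul0r.
Qed.

Lemma hsnorm_sqr m n (A : 'M[R[i]]_(m, n)) : hsnorm A ^+ 2 = rdot A A.
Proof.
rewrite /hsnorm sqr_sqrtr; last first.
  by apply: sumr_ge0 => i _; apply: sumr_ge0 => j _; exact: sqr_ge0.
apply: eq_bigr => i _; apply: eq_bigr => j _.
by rewrite nsq_normc /nsq !expr2.
Qed.

Lemma hsnormB_sqr m n (A B : 'M[R[i]]_(m, n)) :
  hsnorm (A - B) ^+ 2 = rdot A A - 2 * rdot A B + rdot B B.
Proof.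
have NE D : - D = (-1)%:C *: D :> 'M[R[i]]_(m, n) by rewrite rmorphN rmorph1 scaleN1r.
rewrite hsnorm_sqr NE rdotDl rdotZl rdotC rdotDl rdotZl.
rewrite [rdot B (_ + _)]rdotC rdotDl rdotZl (rdotC B A); ring.
Qed.

Lemma hsdot_tens m n p s (A C : 'M[R[i]]_(m, n)) (B D : 'M[R[i]]_(p, s)) :
  hsdot (A *t B) (C *t D) = hsdot A C * hsdot B D.
Proof.
have idx (a b : nat) (F : 'I_(a * b) -> R[i]) :
    \sum_i F i = \sum_i1 \sum_i2 F (mxtens_index (i1, i2)).
  rewrite pair_big /= (reindex (@mxtens_index a b)) /=; last first.
    by exists (@mxtens_unindex a b) => i _; rewrite ?mxtens_indexK ?mxtens_unindexK.
  by apply: eq_bigr => -[i1 i2] _.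
rewrite /hsdot idx mulr_suml; apply: eq_bigr => i1 _.
rewrite mulr_sumr; apply: eq_bigr => i2 _.
rewrite idx mulr_suml; apply: eq_bigr => j1 _.
rewrite mulr_sumr; apply: eq_bigr => j2 _.
by rewrite !tensmxE rmorphM /=; ring.
Qed.

Lemma hsdot_ntens m n (A B : 'M[R[i]]_(m, n)) k :
  hsdot (ntensmx A k) (ntensmx B k) = hsdot A B ^+ k.
Proof.
case: k => [|k].
  by rewrite !ntensmx0 /hsdot !big_ord1 !mxE /= conjC1 mulr1.
rewrite /ntensmx /=; elim: k => [|k ih] /=; first by rewrite expr1.
by rewrite hsdot_tens ih [RHS]exprS.
Qed.

Lemma hsdot_ketbra n (u v : 'cV[R[i]]_n) :
  hsdot (ketbra u) (ketbra v) = (nsq (dot u v))%:C.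
Proof.
rewrite -mulJc -dotJ !dotE mulr_suml; apply: eq_bigr => i _.
rewrite mulr_sumr; apply: eq_bigr => j _.
rewrite /ketbra !mxE !big_ord1 !mxE rmorphM /= conjCK; ring.
Qed.

Lemma rdot_ntens_ketbra n (u v : 'cV[R[i]]_n) k :
  rdot (ntensmx (ketbra u) k) (ntensmx (ketbra v) k) = nsq (dot u v) ^+ k.
Proof. by rewrite rdotE hsdot_ntens hsdot_ketbra -rmorphXn. Qed.

Lemma cmeasurable_ntens d (T : measurableType d) m n (A : T -> 'M[R[i]]_(m, n)) k :
  (forall i j, cmeasurable (fun t => A t i j)) ->
  forall i j, cmeasurable (fun t => ntensmx (A t) k i j).
Proof.
move=> mA; case: k => [|k].
  by move=> i j; under eq_fun do rewrite ntensmx0; exact: cmeasurable_cst.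
rewrite /ntensmx /=; elim: k => [|k ih] //= i j.
by under eq_fun do rewrite mxE; exact: cmeasurableM.
Qed.

Lemma cmeasurable_ketbra d (T : measurableType d) n (v : T -> 'cV[R[i]]_n) :
  vmeasurable v -> forall i j, cmeasurable (fun t => ketbra (v t) i j).
Proof.
move=> mv i j.
have -> : (fun t => ketbra (v t) i j) = (fun t => v t i 0 * ((v t j 0)^*)%R).
  by apply/funext => t; rewrite /ketbra !mxE big_ord1 !mxE.
by apply: cmeasurableM => //; exact: cmeasurableJ.
Qed.

Lemma nsq_entry_le m n (A : 'M[R[i]]_(m, n)) i j : nsq (A i j) <= rdot A A.
Proof.
have h i' j' : Re (A i' j') * Re (A i' j') + Im (A i' j') * Im (A i' j') = nsq (A i' j').
  by rewrite /nsq !expr2.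
rewrite /rdot (bigD1 i) //= (bigD1 j) //= h -addrA lerDl addr_ge0 //.
  by apply: sumr_ge0 => j' _; rewrite h nsq_ge0.
by apply: sumr_ge0 => i' _; apply: sumr_ge0 => j' _; rewrite h nsq_ge0.
Qed.

End HilbertSchmidt.

(** * Pairings with the moment operator of Haar states *)

Section HaarMoment.
Variables (R : realType) (N k : nat).
Local Notation PS := (borel (pure_state R N)).
Variable nu : probability PS R.
Hypothesis hnu : is_haar_state nu.
Local Notation Dk := ('C(2 ^ N + k - 1, k)%:R : R).
Local Notation tens v := (ntensmx (ketbra v) k).

Let rdot_state (v : pure_state R N) : rdot (tens (state_vec v)) (tens (state_vec v)) = 1.
Proof. by rewrite rdot_ntens_ketbra dotuu nsqC sqn_state_vec !expr1n. Qed.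

Let bm_Re i j : bounded_measurable (fun v : PS => Re (tens (state_vec v) i j)).
Proof.
have [m1 _] := cmeasurable_ntens (k := k) (cmeasurable_ketbra (@state_vec_measurable R N)) i j.
split => //; exists 1 => v; rewrite -ler_sqr ?nnegrE // real_normK ?num_real // expr1n.
by rewrite -(rdot_state v); apply: le_trans (nsq_entry_le _ i j); rewrite /nsq lerDl sqr_ge0.
Qed.

Let bm_Im i j : bounded_measurable (fun v : PS => Im (tens (state_vec v) i j)).
Proof.
have [_ m1] := cmeasurable_ntens (k := k) (cmeasurable_ketbra (@state_vec_measurable R N)) i j.
split => //; exists 1 => v; rewrite -ler_sqr ?nnegrE // real_normK ?num_real // expr1n.
by rewrite -(rdot_state v); apply: le_trans (nsq_entry_le _ i j); rewrite /nsq lerDr sqr_ge0.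
Qed.

Lemma rdot_haar A : rdot A (haar_moment k nu) = \int[nu]_v rdot A (tens (state_vec v)).
Proof.
rewrite /rdot.
have bt i j : bounded_measurable (fun v : PS =>
    Re (A i j) * Re (tens (state_vec v) i j) + Im (A i j) * Im (tens (state_vec v) i j)).
  by apply: bmD; exact: bmZ.
rewrite Ex_sum; last by move=> i; exact: bm_sum.
apply: eq_bigr => i _; rewrite Ex_sum //; apply: eq_bigr => j _.
rewrite ExD; [|exact: bmZ|exact: bmZ].
by rewrite !ExZ // /haar_moment mxE.
Qed.

Lemma rdot_ketbra_haar (u : 'cV[R[i]]_(2 ^ N)) : sqn u = 1 ->
  rdot (tens u) (haar_moment k nu) = Dk^-1.
Proof.
move=> nu1; rewrite rdot_haar -(state_moment hnu k nu1); apply: eq_Rintegral => v _.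
by rewrite rdot_ntens_ketbra /ov nu1 sqn_state_vec mulr1 divr1.
Qed.

(** The overlap of a single state with the Haar moment is the same for all states, so averaging over
    a second state keeps its value. *)
Lemma rdot_haar_haar : rdot (haar_moment k nu) (haar_moment k nu) = Dk^-1.
Proof.
rewrite rdot_haar -[RHS](Ex_cst nu); apply: eq_Rintegral => v _.
by rewrite rdotC rdot_ketbra_haar // sqn_state_vec.
Qed.

End HaarMoment.

(** * The same-block bound averaged over both columns *)

Lemma bm_Ex_perp_overlap d1 d2 (T1 : measurableType d1) (T2 : measurableType d2)
    (R : realType) (P1 : probability T1 R) (P2 : probability T2 R) m n (E : 'M[R[i]]_(m, n)) k
    (x : T1 -> 'cV[R[i]]_m) (y : T2 -> 'cV[R[i]]_m) :
  E^t* *m E = 1%:M -> vmeasurable x -> vmeasurable y ->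
  (forall s, sqn (x s) = 1) -> (forall t, sqn (y t) = 1) ->
  bounded_measurable (fun s => \int[P2]_t block_overlap E k (x s) (perp (x s) (y t))).
Proof.
move=> EE mx my x1 y1.
have m1 := @measurable_fst _ _ T1 T2; have m2 := @measurable_snd _ _ T1 T2.
have mx1 := vmeasurable_comp m1 mx; have my2 := vmeasurable_comp m2 my.
apply: (bm_Ex2 P1 P2 (f := fun s t => block_overlap E k (x s) (perp (x s) (y t)))).
apply: (@bm_block_overlap R m n E k EE _ (T1 * T2)%type (fun z => x z.1)
  (fun z => perp (x z.1) (y z.2))) => //.
- exact: vmeasurable_perp.
- by move=> z; rewrite x1.
- by move=> z; rewrite sqn_perp // y1 gerBl nsq_ge0.
Qed.

Lemma bernoulli_le (R : realDomainType) (a : R) n : 0 <= a -> a <= 1 ->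
  1 - n%:R * a <= (1 - a) ^+ n.
Proof.
move=> a0 a1; elim: n => [|n ih]; first by rewrite mul0r subr0 expr0.
rewrite exprS; apply: (@le_trans _ _ ((1 - a) * (1 - n%:R * a))).
  have := mulr_ge0 (ler0n R n) (mulr_ge0 a0 a0); rewrite -natr1; nra.
by apply: ler_wpM2l => //; rewrite subr_ge0.
Qed.

Section PairBound.
Variables (R : realType) (m : nat) (mu : probability (borel (unitary_group R m)) R).
Local Notation UG := (borel (unitary_group R m)).
Hypothesis hmu : is_haar mu.
Variables (n : nat) (E : 'M[R[i]]_(m, n)).
Hypothesis EE : E^t* *m E = 1%:M.
Variables phi psi : 'cV[R[i]]_m.
Hypotheses (nphi : sqn phi = 1) (npsi : sqn psi = 1) (phipsi : dot phi psi = 0).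
Hypotheses (n0 : (0 < n)%N) (m2 : (1 < m)%N).

Local Notation col U x := (unitary_mx U *m x).
Let a (U : UG) := sqn (E^t* *m col U phi).
Let rho : R := n%:R / m%:R.
Let I k := \int[mu]_U block_overlap E k (col U phi) (col U psi).
Let Dk k : R := 'C(n + k - 1, k)%:R.
Let alpha := \int[mu]_U a U ^+ 2.

Let Dk_gt0 k : 0 < Dk k.
Proof. by rewrite ltr0n bin_gt0; lia. Qed.

Let ba : bounded_measurable a. Proof. exact: bm_sqn_block. Qed.
Let a_le1 U : a U <= 1.
Proof. by rewrite -nphi -(sqn_unitary U phi); exact: sqn_adj_le. Qed.

Let J k (U : UG) := \int[mu]_W block_overlap E k (col U phi) (perp (col U phi) (col W psi)).

Let bJ k : bounded_measurable (J k).
Proof.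
apply: (bm_Ex_perp_overlap mu mu k (x := fun U : UG => col U phi)
  (y := fun U : UG => col U psi) EE).
- exact: unitary_vec_measurable.
- exact: unitary_vec_measurable.
- by move=> U; rewrite sqn_unitary.
- by move=> U; rewrite sqn_unitary.
Qed.

(** After [column_swap], the bounds [a (1 - a)^(k + 1)] and [a], up to a common factor, are
    integrated over the first column. Bernoulli's inequality leaves only the first two moments of
    [a], namely [rho] and [alpha]. *)
Let pair_bounds k :
  rho * (rho - k.+1%:R * alpha) <= (1 - m%:R^-1) * (Dk k * I k) /\
  (1 - m%:R^-1) * (Dk k * I k) <= rho * rho.
Proof.
have EJ : (1 - m%:R^-1) * I k = \int[mu]_U J k U by exact: column_swap.
have Ea : \int[mu]_U a U = rho by exact: block_sqn_moment1.
have D0 := Dk_gt0 k.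
have rho0 : 0 <= rho by rewrite divr_ge0.
have bnd U := perp_overlap_bounds hmu EE npsi k (X := col U phi)
  (etrans (sqn_unitary U phi) nphi) n0.
have zle z : 0 <= z -> 0 <= rho / Dk k * z.
  by move=> z0; rewrite mulr_ge0 // divr_ge0 // ltW.
have lo U : rho / Dk k * (a U - k.+1%:R * a U ^+ 2) <= J k U.
  apply: le_trans (bnd U).1; rewrite -/(a U) mulrC -/(Dk k) -/rho.
  apply: ler_wpM2r; first by rewrite divr_ge0 // ltW.
  have h := bernoulli_le k.+1 (sqn_ge0 _) (a_le1 U).
  have := ler_wpM2l (sqn_ge0 (E^t* *m col U phi)) h.
  rewrite -/(a U) expr2; lra.
have hi U : J k U <= rho / Dk k * a U.
  by apply: le_trans (bnd U).2 _; rewrite -/(a U) mulrC -/(Dk k) -/rho.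
have ba2 : bounded_measurable (fun U => k.+1%:R * a U ^+ 2).
  by apply: bmZ; exact: bmX.
have := le_Ex mu (bmZ (rho / Dk k) (bmB ba ba2)) (bJ k) lo.
have := le_Ex mu (bJ k) (bmZ (rho / Dk k) ba) hi.
rewrite (ExZ mu (rho / Dk k) (bmB ba ba2)) (ExZ mu (rho / Dk k) ba).
rewrite (ExB mu ba ba2) (ExZ mu k.+1%:R (bmX 2 ba)) -/alpha Ea -EJ.
move: (I k) => z.
rewrite ![rho / Dk k * _]mulrAC ler_pdivlMr // ler_pdivrMr //.
by rewrite -!mulrA ![z * _]mulrC => -> ->.
Qed.

(** For exponents [k] and 0 alike, the quantity times [1 - 1 / m] lies at most [rho (k + 1) alpha],
    respectively [rho alpha], below the common value [rho^2]. The difference cancels [rho^2], and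
    dividing by [1 - 1 / m >= 1 / 2] costs the factor 2. *)
Lemma block_pair_bound k :
  `|Dk k * I k - I 0| <= 2 * rho * k.+1%:R * alpha.
Proof.
have [l1 u1] := pair_bounds k; have [l0 u0] := pair_bounds 0.
have D0 : Dk 0 = 1 by rewrite /Dk bin0.
rewrite D0 mul1r in l0 u0.
have m2' : 2 <= m%:R :> R by rewrite ler_nat.
have mV : m%:R^-1 <= 2^-1 :> R by rewrite lef_pV2 ?posrE //; lra.
have alpha0 : 0 <= alpha by apply: Ex_ge0 => U; exact: sqr_ge0.
have rho0 : 0 <= rho by rewrite divr_ge0.
have ra := mulr_ge0 rho0 alpha0.
have rak : rho * alpha <= rho * alpha * k.+1%:R.
  by rewrite ler_peMr // ler1n.
set z := Dk k * I k in l1 u1 *; set w := I 0 in l0 u0 *.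
have p0 : 2^-1 <= 1 - m%:R^-1 :> R by lra.
set p := 1 - m%:R^-1 in p0 l1 u1 l0 u0.
have b1 : p * (z - w) <= rho * alpha * k.+1%:R by lra.
have b2 : - (rho * alpha * k.+1%:R) <= p * (z - w) by lra.
set B := rho * alpha * k.+1%:R in rak b1 b2.
have -> : 2 * rho * k.+1%:R * alpha = 2 * B by rewrite /B; ring.
have B0 : 0 <= B by lra.
move: (z - w) b1 b2 => y b1 b2.
rewrite ler_norml; apply/andP; split; have [y0|y0] := leP 0 y; nra.
Qed.

End PairBound.

(** * The projected ensemble *)

Section Blocks.
Variables (R : realType) (NA NB : nat).
Local Notation d := (2 ^ NA)%N.
Local Notation b := (2 ^ NB)%N.

(** The isometry [|a> -> |a>|z>], whose adjoint is [project z]: measurement outcomes become mutually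
    orthogonal blocks. *)
Definition block_emb (z : 'I_b) : 'M[R[i]]_(d * b, d) :=
  \matrix_(i, a) (i == mxtens_index (a, z))%:R.

Let adj_block_embE z a i : ((block_emb z)^t*) a i = (i == mxtens_index (a, z))%:R.
Proof. by rewrite !mxE rmorph_nat. Qed.

Lemma adj_block_emb_mul z v : (block_emb z)^t* *m v = project z v.
Proof.
apply/colP => a; rewrite !mxE (bigD1 (mxtens_index (a, z))) //= big1 => [|i ia].
  by rewrite adj_block_embE eqxx mul1r addr0.
by rewrite adj_block_embE (negbTE ia) mul0r.
Qed.

Lemma adj_block_emb_emb z w :
  (block_emb w)^t* *m block_emb z = (z == w)%:R%:M.
Proof.
apply/matrixP => a a'; rewrite [LHS]mxE (bigD1 (mxtens_index (a, w))) //= big1 => [|i ia].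
  rewrite adj_block_embE eqxx mul1r addr0 !mxE.
  rewrite (can_eq (@mxtens_indexK _ _)) xpair_eqE [w == z]eq_sym.
  by case: (z == w); rewrite ?andbT ?andbF ?mul0rn // -mulr_natr mul1r.
by rewrite adj_block_embE (negbTE ia) mul0r.
Qed.

Lemma sqn_sum_project (v : 'cV[R[i]]_(d * b)) : sqn v = \sum_z sqn (project z v).
Proof.
rewrite /sqn exchange_big pair_big /= (reindex (@mxtens_index d b)) /=; last first.
  by exists (@mxtens_unindex d b) => i _; rewrite ?mxtens_indexK ?mxtens_unindexK.
by apply: eq_bigr => -[i1 i2] _; rewrite mxE.
Qed.

End Blocks.

Section Ensemble.
Variables (R : realType) (NA NB : nat) (X : finType).
Variables (q : X -> R) (phi : X -> 'cV[R[i]]_(2 ^ NA * 2 ^ NB)) (k : nat).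
Local Notation d := (2 ^ NA)%N.
Local Notation b := (2 ^ NB)%N.
Local Notation UG := (borel (unitary_group R (d * b))).
Variables (nu : probability (borel (pure_state R NA)) R) (mu : probability UG R).
Hypotheses (hnu : is_haar_state nu) (hmu : is_haar mu).
Hypotheses (q_distr : is_distr q) (phi_on : orthonormal_kets phi).
Local Notation Dk := ('C(d + k - 1, k)%:R : R).

Let u (U : UG) x z := unnorm_state phi U x z.

Definition pair_overlap j x z y w (U : UG) : R :=
  sqn (u U x z) * sqn (u U y w) * ov (u U x z) (u U y w) ^+ j.

Lemma dot_kets x y : dot (phi x) (phi y) = (x == y)%:R.
Proof. by rewrite /dot phi_on mxE mulr1n. Qed.

Lemma sqn_ket x : sqn (phi x) = 1.
Proof. by rewrite sqnE dot_kets eqxx. Qed.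

Let bornE U x z : born phi U x z = sqn (u U x z).
Proof.
rewrite /born hsnorm_sqr /rdot /sqn; apply: eq_bigr => a _.
by rewrite big_ord1 /nsq !expr2.
Qed.

Lemma sum_sqn_unnorm U x : \sum_z sqn (u U x z) = 1.
Proof. by rewrite -sqn_sum_project sqn_unitary sqn_ket. Qed.

Let post_unit U x z : born phi U x z != 0 -> sqn (post_state phi U x z) = 1.
Proof.
move=> p0; rewrite /post_state sqnZ nsqC exprVn sqr_sqrtr ?bornE ?sqn_ge0 //.
by rewrite mulVf // -bornE.
Qed.

Let post_overlap U x z y w : born phi U x z != 0 -> born phi U y w != 0 ->
  nsq (dot (post_state phi U x z) (post_state phi U y w)) = ov (u U x z) (u U y w).
Proof.
move=> p0 p1; rewrite -[LHS]divr1 -[in X in _ / X](mulr1 1).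
rewrite -{1}(post_unit p0) -(post_unit p1) -/(ov _ _).
have nz x' z' : born phi U x' z' != 0 -> ((Num.sqrt (born phi U x' z'))^-1)%:C != 0.
  move=> p; rewrite eq_complex /= eqxx andbT invr_eq0 sqrtr_eq0 -ltNge.
  by rewrite lt_neqAle eq_sym p bornE sqn_ge0.
by rewrite /post_state ovZl ?ovZr // nz.
Qed.

Let rdot_moment U B : rdot (moment q phi k U) B =
  \sum_x \sum_z q x * born phi U x z * rdot (ntensmx (ketbra (post_state phi U x z)) k) B.
Proof.
rewrite /moment rdot_suml; apply: eq_bigr => x _.
rewrite rdot_suml big_mkcond; apply: eq_bigr => z _.
case: ifPn => [_|]; first by rewrite rdotZl.
by rewrite negbK => /eqP ->; rewrite mulr0 mul0r.
Qed.

Let rdot_moment_haar U : rdot (moment q phi k U) (haar_moment k nu) = Dk^-1.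
Proof.
rewrite rdot_moment; transitivity (\sum_x \sum_z q x * sqn (u U x z) * Dk^-1).
  apply: eq_bigr => x _; apply: eq_bigr => z _; rewrite bornE.
  have [->|p0] := eqVneq (sqn (u U x z)) 0; first by rewrite mulr0 !mul0r.
  by rewrite (rdot_ketbra_haar k hnu) // post_unit // bornE.
under eq_bigr => x _.
  under eq_bigr => z _ do rewrite mulrAC.
  rewrite -mulr_sumr sum_sqn_unnorm mulr1.
over.
by rewrite -mulr_suml q_distr.2 mul1r.
Qed.

Let rdot_moment_moment U : rdot (moment q phi k U) (moment q phi k U) =
  \sum_x \sum_y q x * q y * \sum_z \sum_w pair_overlap k x z y w U.
Proof.
rewrite rdot_moment; apply: eq_bigr => x _.
under eq_bigr => z _ do rewrite rdotC rdot_moment mulr_sumr.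
rewrite exchange_big; apply: eq_bigr => y _ /=.
rewrite mulr_sumr; apply: eq_bigr => z _.
rewrite !mulr_sumr; apply: eq_bigr => w _.
rewrite rdot_ntens_ketbra /pair_overlap !bornE.
have [->|p0] := eqVneq (sqn (u U x z)) 0; first by rewrite !(mulr0, mul0r).
have [->|p1] := eqVneq (sqn (u U y w)) 0; first by rewrite !(mulr0, mul0r).
by rewrite post_overlap ?bornE // ovC; ring.
Qed.

Let Dk_gt0 : 0 < Dk.
Proof. by rewrite ltr0n bin_gt0; have := expn_gt0 2 NA; lia. Qed.

Lemma hs_distance_sqr U : hs_distance q phi k nu U ^+ 2 =
  Dk * (\sum_x \sum_y q x * q y * \sum_z \sum_w pair_overlap k x z y w U) - 1.
Proof.
rewrite /hs_distance expr_div_n hsnormB_sqr hsnorm_sqr (rdot_haar_haar k hnu).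
rewrite rdot_moment_haar rdot_moment_moment invrK.
set S := \sum_x _; have := Dk_gt0; move: (Dk) => D D0.
by field; rewrite gt_eqF.
Qed.

Lemma bm_pair_overlap j x z y w : bounded_measurable (pair_overlap j x z y w).
Proof.
have mu1 x' z' : vmeasurable (fun U : UG => u U x' z').
  move=> i; under eq_fun do rewrite /u /unnorm_state mxE.
  exact: unitary_vec_measurable.
have bs x' z' : bounded_measurable (fun U : UG => sqn (u U x' z')).
  split; first exact: measurable_sqn.
  exists 1 => U; rewrite ger0_norm ?sqn_ge0 // -(sum_sqn_unnorm U x').
  by rewrite (bigD1 z') //= lerDl; apply: sumr_ge0 => l _; exact: sqn_ge0.
apply: bmM; first exact: bmM.
by apply: bmX; exact: bm_ov.
Qed.

Let Ov j x z y w := \int[mu]_U pair_overlap j x z y w U.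

(** Distributes the [- 1] of [hs_distance_sqr] over the same indices as the overlaps, so that
    [Dk * Ov k - Ov 0] can be estimated term by term. *)
Let Ov0_total : \sum_x \sum_y q x * q y * \sum_z \sum_w Ov 0 x z y w = 1.
Proof.
have inner x y : \sum_z \sum_w Ov 0 x z y w = 1.
  rewrite -[RHS](Ex_cst mu).
  have bp z w := bm_pair_overlap 0 x z y w.
  under eq_bigr => z _ do rewrite -Ex_sum //.
  rewrite -Ex_sum; last by move=> z; exact: bm_sum.
  apply: eq_Rintegral => U _; rewrite /pair_overlap.
  under eq_bigr => z _.
    under eq_bigr => w _ do rewrite expr0 mulr1.
    rewrite -mulr_sumr sum_sqn_unnorm mulr1.
  over.
  exact: sum_sqn_unnorm.
under eq_bigr => x _.
  under eq_bigr => y _ do rewrite inner mulr1.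
  rewrite -mulr_sumr q_distr.2 mulr1.
over.
exact: q_distr.2.
Qed.

Let Ov_offblock x z y w : z != w -> Dk * Ov k x z y w = Ov 0 x z y w.
Proof.
move=> zw.
have e1 := adj_block_emb_emb R NA z z; rewrite eqxx in e1.
have e2 := adj_block_emb_emb R NA w w; rewrite eqxx in e2.
have e3 := adj_block_emb_emb R NA z w; rewrite (negbTE zw) raddf0 in e3.
have := block_decorrelation hnu hmu k e1 e2 e3 (sqn_ket x) (sqn_ket y).
rewrite /= => e.
have -> : Ov k x z y w = \int[mu]_U (sqn ((block_emb R NA z)^t* *m (unitary_mx U *m phi x)) *
   sqn ((block_emb R NA w)^t* *m (unitary_mx U *m phi y)) *
   ov ((block_emb R NA z)^t* *m (unitary_mx U *m phi x))
     ((block_emb R NA w)^t* *m (unitary_mx U *m phi y)) ^+ k).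
  by apply: eq_Rintegral => U _; rewrite !adj_block_emb_mul.
rewrite e mulrC divfK ?gt_eqF //; apply: eq_Rintegral => U _.
by rewrite !adj_block_emb_mul /pair_overlap expr0 mulr1.
Qed.

Let Ov_same_block j x z y :
  Ov j x z y z = \int[mu]_U block_overlap (block_emb R NA z) j
    (unitary_mx U *m phi x) (unitary_mx U *m phi y).
Proof.
by apply: eq_Rintegral => U _; rewrite /block_overlap !adj_block_emb_mul.
Qed.

Let alpha : R := d%:R * (d%:R + 1) / ((d * b)%:R * ((d * b)%:R + 1)).

Let block_sqn2 x z :
  \int[mu]_U sqn ((block_emb R NA z)^t* *m (unitary_mx U *m phi x)) ^+ 2 = alpha.
Proof.
have inj : injective (fun a : 'I_d => mxtens_index (a, z)).
  by move=> a a' /(can_inj (@mxtens_indexK _ _)) [].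
rewrite /alpha -(block_sqn_moment2 hmu (sqn_ket x) inj).
apply: eq_Rintegral => U _; rewrite adj_block_emb_mul; congr (_ ^+ _).
by apply: eq_bigr => a _; rewrite mxE.
Qed.

Let Ov_diag x z : Dk * Ov k x z x z - Ov 0 x z x z = (Dk - 1) * alpha.
Proof.
have e j : Ov j x z x z = alpha.
  rewrite -(block_sqn2 x z); apply: eq_Rintegral => U _.
  rewrite adj_block_emb_mul /pair_overlap -/(u U x z) -expr2.
  have [->|p0] := eqVneq (sqn (u U x z)) 0; first by rewrite expr0n mul0r.
  have -> : ov (u U x z) (u U x z) = 1.
    have p2 : sqn (u U x z) ^+ 2 != 0 by rewrite sqrf_eq0.
    by apply: (mulfI p2); rewrite ov_self mulr1.
  by rewrite expr1n mulr1.
by rewrite !e mulrBl mul1r.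
Qed.

Let Ov_offdiag x y z : (1 < d * b)%N -> x != y ->
  `|Dk * Ov k x z y z - Ov 0 x z y z| <= 2 * (d%:R / (d * b)%:R) * k.+1%:R * alpha.
Proof.
move=> db xy; have d0 : (0 < d)%N by rewrite expn_gt0.
have e1 := adj_block_emb_emb R NA z z; rewrite eqxx in e1.
have dxy : dot (phi x) (phi y) = 0 by rewrite dot_kets (negbTE xy).
have := block_pair_bound hmu e1 (sqn_ket x) (sqn_ket y) dxy d0 db k.
by rewrite -!Ov_same_block block_sqn2.
Qed.

(** Only [z = w] survives. The terms [x = y] give the centre exactly; each of the others is at most
    [B] per block, and their weights [q x * q y] sum to at most 1, which leaves [b * B]. *)
Lemma expected_sqr_distance : (1 < d * b)%N ->
  `|\int[mu]_U (hs_distance q phi k nu U ^+ 2) - (\sum_x q x ^+ 2) * b%:R * ((Dk - 1) * alpha)|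
  <= b%:R * (2 * (d%:R / (d * b)%:R) * k.+1%:R * alpha).
Proof.
move=> db; set B := 2 * _ * _ * _.
have -> : \int[mu]_U (hs_distance q phi k nu U ^+ 2) =
    \sum_x \sum_y q x * q y * \sum_z (Dk * Ov k x z y z - Ov 0 x z y z).
  have bp x y z w := bm_pair_overlap k x z y w.
  have bzw x y : bounded_measurable (fun U => \sum_z \sum_w pair_overlap k x z y w U).
    by apply: bm_sum => z; exact: bm_sum.
  have bxy : bounded_measurable (fun U =>
      \sum_x \sum_y q x * q y * \sum_z \sum_w pair_overlap k x z y w U).
    by apply: bm_sum => x; apply: bm_sum => y; exact: bmZ.
  under eq_Rintegral do rewrite hs_distance_sqr.
  rewrite ExB; [|exact: bmZ|exact: bm_cst]; rewrite Ex_cst ExZ // Ex_sum; last first.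
    by move=> x; apply: bm_sum => y; exact: bmZ.
  rewrite -[X in _ - X]Ov0_total mulr_sumr -sumrB; apply: eq_bigr => x _.
  rewrite Ex_sum; last by move=> y; exact: bmZ.
  rewrite mulr_sumr -sumrB; apply: eq_bigr => y _.
  rewrite ExZ // mulrCA -mulrBr; congr (_ * _).
  rewrite Ex_sum; last by move=> z; exact: bm_sum.
  rewrite mulr_sumr -sumrB; apply: eq_bigr => z _.
  rewrite Ex_sum // mulr_sumr -sumrB (bigD1 z) //= big1 ?addr0 // => w wz.
  by rewrite Ov_offblock 1?eq_sym // subrr.
have q0 : forall x, 0 <= q x := q_distr.1.
have d0 : 0 <= d%:R :> R by [].
have alpha0 : 0 <= alpha by rewrite divr_ge0 ?mulr_ge0 ?addr_ge0.
have B0 : 0 <= B by rewrite !mulr_ge0 // invr_ge0.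
rewrite -mulrA mulr_suml -sumrB.
apply: le_trans (ler_norm_sum _ _ _) _.
have -> : b%:R * B = \sum_x q x * (b%:R * B) by rewrite -mulr_suml q_distr.2 mul1r.
apply: ler_sum => x _.
rewrite (bigD1 x) //= addrAC.
have -> : q x * q x * (\sum_z (Dk * Ov k x z x z - Ov 0 x z x z)) -
    q x ^+ 2 * (b%:R * ((Dk - 1) * alpha)) = 0.
  under eq_bigr => z _ do rewrite Ov_diag.
  by rewrite sumr_const card_ord -[_ *+ b]mulr_natl expr2 subrr.
rewrite add0r; apply: le_trans (ler_norm_sum _ _ _) _.
apply: (@le_trans _ _ (\sum_(y | y != x) q x * q y * (b%:R * B))).
  apply: ler_sum => y yx; rewrite normrM ger0_norm ?mulr_ge0 //.
  apply: ler_wpM2l; first exact: mulr_ge0.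
  apply: le_trans (ler_norm_sum _ _ _) _.
  apply: (@le_trans _ _ (\sum_(z < b) B)); last by rewrite sumr_const card_ord mulr_natl.
  by apply: ler_sum => z _; apply: Ov_offdiag => //; rewrite eq_sym.
rewrite -mulr_suml -mulr_sumr -mulrA; apply: ler_wpM2l => //.
rewrite -[leRHS]mul1r; apply: ler_wpM2r; first by rewrite mulr_ge0.
by rewrite -q_distr.2 [leRHS](bigD1 x) //= lerDr.
Qed.

Lemma rms_distance_sqr :
  rms_distance q phi k nu mu ^+ 2 = \int[mu]_U (hs_distance q phi k nu U ^+ 2).
Proof.
rewrite /rms_distance unlock sqr_sqrtr //.
by apply: Ex_ge0 => U; exact: sqr_ge0.
Qed.

(** Orthonormal kets number at most [d * b], by the rank of the matrix they form, and the purity on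
    [N] points is at least [1 / N] because the sum of the squares of [q x - 1 / N] is
    nonnegative. *)
Lemma purity_ge : ((d * b)%:R)^-1 <= \sum_x q x ^+ 2.
Proof.
pose A : 'M[R[i]]_(#|X|, d * b) := \matrix_(x, i) ((phi (enum_val x) i 0)^*)%R.
have Au : A \is unitarymx.
  apply/unitarymxP/matrixP => x y; rewrite !mxE.
  have := dot_kets (enum_val x) (enum_val y).
  rewrite dotE (inj_eq enum_val_inj) => <-; apply: eq_bigr => i _.
  by rewrite !mxE conjCK.
have cX : (#|X| <= d * b)%N by rewrite -(mxrank_unitary Au) rank_leq_col.
have X0 : (0 < #|X|)%N.
  rewrite lt0n; apply/negP => /eqP /card0_eq X0.
  have := q_distr.2; rewrite big_pred0 => [/eqP|x]; last exact: (X0 x).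
  by rewrite eq_sym oner_eq0.
set N := #|X| in cX X0.
have N0 : N%:R != 0 :> R by rewrite pnatr_eq0 -lt0n.
apply: (@le_trans _ _ N%:R^-1).
  by rewrite lef_pV2 ?posrE ?ltr0n ?ler_nat //; exact: leq_trans cX.
have : 0 <= \sum_x (q x - N%:R^-1) ^+ 2 by apply: sumr_ge0 => x _; exact: sqr_ge0.
have -> : \sum_x (q x - N%:R^-1) ^+ 2 = \sum_x q x ^+ 2 - N%:R^-1.
  transitivity (\sum_x (q x ^+ 2 - (2 * N%:R^-1) * q x + N%:R^-1 ^+ 2)).
    by apply: eq_bigr => x _; ring.
  rewrite big_split sumrB /= -mulr_sumr q_distr.2 sumr_const -[_ *+ _]mulr_natl -/N.
  by field.
by rewrite subr_ge0.
Qed.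

End Ensemble.

(** * Asymptotics *)

(** The ratio is the product of [1 + j / d] over [j < k]. In the induction [(1 + c / d) (1 + k / d)]
    is at most [1 + (c + k + c k) / d], because [d >= 1]. *)
Lemma symmetric_dim_ratio (R : realType) k : exists2 c : R, 0 <= c &
  forall d : nat, (0 < d)%N ->
    (1 : R) <= k`!%:R * 'C(d + k - 1, k)%:R / d%:R ^+ k <= 1 + c / d%:R.
Proof.
elim: k => [|k [c c0 ih]].
  by exists 0 => // d d0; rewrite fact0 bin0 expr0 mulr1 divr1 mul0r addr0 lexx.
exists (c + k%:R + c * k%:R) => [|d d0]; first by rewrite !addr_ge0 ?mulr_ge0.
have dp : 1 <= d%:R :> R by rewrite ler1n.
have d1 : 0 < d%:R :> R by rewrite ltr0n.
have -> : k.+1`!%:R * 'C(d + k.+1 - 1, k.+1)%:R / d%:R ^+ k.+1 =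
  (k`!%:R * 'C(d + k - 1, k)%:R / d%:R ^+ k) * (1 + k%:R / d%:R) :> R.
  rewrite (_ : d + k.+1 - 1 = d + k)%N; last by lia.
  have -> : k.+1`!%:R * 'C(d + k, k.+1)%:R =
    k`!%:R * ((d%:R + k%:R) * 'C(d + k - 1, k)%:R) :> R.
    rewrite -natrD -!natrM subn1 mul_bin_diag factS; congr (_%:R).
    by rewrite mulnCA mulnA.
  move: (k`!%:R) ('C(d + k - 1, k)%:R) => x y.
  by rewrite exprS; field; rewrite expf_neq0 ?gt_eqF.
have /andP[l u] := ih d d0; set r := _ / _ in l u *.
have kd : 0 <= k%:R / d%:R :> R by rewrite divr_ge0.
have dV : d%:R^-1 <= 1 :> R by rewrite invf_le1.
have dV0 : 0 <= d%:R^-1 :> R by rewrite invr_ge0.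
apply/andP; split; first by nra.
apply: (@le_trans _ _ ((1 + c / d%:R) * (1 + k%:R / d%:R))).
  by apply: ler_wpM2r => //; rewrite addr_ge0.
have k0 : 0 <= k%:R :> R by [].
move: (d%:R^-1) (k%:R : R) dV dV0 k0 => e z e1 e0 z0.
have := mulr_ge0 (mulr_ge0 c0 z0) (mulr_ge0 e0 (_ : 0 <= 1 - e)).
rewrite subr_ge0 => /(_ e1); nra.
Qed.

(* Here [d] and [b] are the two dimensions, [P] the purity of the input
   distribution, [r] the ratio of the symmetric dimension to [d ^ k / k!]. *)
Lemma ratio_estimate (R : realType) (d b P E r c f : R) k :
  1 <= d -> 1 <= b -> (d * b)^-1 <= P -> 0 <= c -> (2 <= k)%N ->
  1 <= r -> r <= 1 + c / d ->
  let alpha := d * (d + 1) / (d * b * (d * b + 1)) in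
  `|E - P * b * ((r * d ^+ k / f - 1) * alpha)|
     <= b * (2 * (d / (d * b)) * k.+1%:R * alpha) ->
  0 < f ->
  `|E / (P * d ^+ k / (f * b)) - 1| <= (2 * c + 1 + 2 * f + 4 * k.+1%:R * f) / d.
Proof.
move=> d1 b1 P_ge c0 k2 r1 rc alpha hE f0.
have d0 : 0 < d by lra. have b0 : 0 < b by lra.
have db0 : 0 < d * b by rewrite mulr_gt0.
have P0 : 0 < P by apply: lt_le_trans P_ge; rewrite invr_gt0.
have dk0 : 0 < d ^+ k by rewrite exprn_gt0.
set M := P * d ^+ k / (f * b).
have M0 : 0 < M by rewrite divr_gt0 ?mulr_gt0.
(* [alpha] is [s / b ^+ 2], and [s] lies between 1 and [1 + 1 / d]. *)
pose s := b * (d + 1) / (d * b + 1).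
have s1 : 1 <= s by rewrite ler_pdivlMr; lra.
have s2 : s <= 1 + d^-1.
  rewrite ler_pdivrMr; last by lra.
  have -> : (1 + d^-1) * (d * b + 1) = b * (d + 1) + 1 + d^-1.
    by field; rewrite gt_eqF.
  have : 0 < d^-1 by rewrite invr_gt0.
  lra.
have dV1 : d^-1 <= 1 by rewrite invf_le1.
have dV0 : 0 < d^-1 by rewrite invr_gt0.
have aE : alpha = s / b ^+ 2.
  rewrite /alpha /s; field; rewrite !gt_eqF //; lra.
have main : P * b * ((r * d ^+ k / f - 1) * alpha) / M = (r - f / d ^+ k) * s.
  rewrite aE /M; move: (d ^+ k) dk0 => y y0.
  by field; rewrite !gt_eqF.
have dk2 : d ^+ 2 <= d ^+ k by apply: ler_weXn2l.
have fdk : f / d ^+ k <= f / d.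
  rewrite ler_pM2l // lef_pV2 ?posrE //; apply: le_trans dk2; rewrite expr2; nra.
have fdk0 : 0 <= f / d ^+ k by rewrite divr_ge0 // ltW.
(* The quotient is [2 (k + 1) s f / (b P d^k)]. The purity bound gives [1 / (b P) <= d], then
   [k >= 2] gives [d / d^k <= 1 / d], and [s <= 2]. *)
have err : b * (2 * (d / (d * b)) * k.+1%:R * alpha) / M <= 4 * k.+1%:R * f / d.
  rewrite ler_pdivrMr // aE.
  have -> : b * (2 * (d / (d * b)) * k.+1%:R * (s / b ^+ 2)) = 2 * k.+1%:R * s / b ^+ 2.
    by field; rewrite !gt_eqF.
  have -> : 4 * k.+1%:R * f / d * M = 2 * k.+1%:R * (2 * (P * d ^+ k / (d * b))).
    by rewrite /M; field; rewrite !gt_eqF.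
  rewrite -mulrA; apply: ler_wpM2l; first by rewrite mulr_ge0.
  have -> : P * d ^+ k / (d * b) = P * (d * b) * d ^+ k / (d ^+ 2 * b ^+ 2).
    by field; rewrite !gt_eqF.
  have PD : 1 <= P * (d * b) by rewrite -ler_pdivrMr // div1r.
  rewrite ler_pdivrMr ?exprn_gt0 //.
  have -> : 2 * (P * (d * b) * d ^+ k / (d ^+ 2 * b ^+ 2)) * b ^+ 2
     = 2 * (P * (d * b) * (d ^+ k / d ^+ 2)).
    move: (d ^+ k) => y; by field; rewrite !gt_eqF.
  have : 1 <= d ^+ k / d ^+ 2 by rewrite ler_pdivlMr ?exprn_gt0 // mul1r.
  move: (P * (d * b)) (d ^+ k / d ^+ 2) PD => x y; nra.
have -> : E / M - 1 = (E - P * b * ((r * d ^+ k / f - 1) * alpha)) / M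
    + ((r - f / d ^+ k) * s - 1).
  by rewrite -main; ring.
apply: le_trans (ler_normD _ _) _.
have e1 : `|(E - P * b * ((r * d ^+ k / f - 1) * alpha)) / M| <= 4 * k.+1%:R * f / d.
  apply: le_trans err; rewrite normrM normfV (gtr0_norm M0).
  by apply: ler_wpM2r => //; rewrite invr_ge0 ltW.
(* From above, [r s <= (1 + c / d) (1 + 1 / d) <= 1 + (2 c + 1) / d]; from below, [r s >= 1] and the
   subtracted term is at most [2 f / d]. *)
have e2 : `|(r - f / d ^+ k) * s - 1| <= (2 * c + 1 + 2 * f) / d.
  rewrite [(2 * c + 1 + 2 * f) / d]mulrDl [(2 * c + 1) / d]mulrDl mul1r -!mulrA.
  move: (f / d) (f / d ^+ k) fdk fdk0 => g h gh h0.
  have cd0 : 0 <= c / d by rewrite divr_ge0 // ltW.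
  have ccd : 0 <= c / d * (1 - d^-1) by rewrite mulr_ge0 ?subr_ge0.
  move: (d^-1) (c / d) rc s2 dV1 dV0 cd0 ccd => e x rx se e1' e0' x0 xe.
  rewrite ler_norml; apply/andP; split.
    have : 0 <= (r - 1) * s by rewrite mulr_ge0 //; lra.
    have : h * s <= h * 2 by apply: ler_wpM2l => //; lra.
    nra.
  have rs : r * s <= (1 + x) * (1 + e).
    apply: ler_pM; [exact: le_trans ler01 r1|exact: le_trans ler01 s1|exact: rx|exact: se].
  have : 0 <= h * s by rewrite mulr_ge0 //; lra.
  nra.
apply: le_trans (lerD e1 e2) _; rewrite -mulrDl.
rewrite le_eqVlt; apply/orP; left; apply/eqP; congr (_ / _); ring.
Qed.

Lemma target_value (R : realType) (X : finType) (q : X -> R) (NA NB k : nat) :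
  0 < \sum_x q x ^+ 2 ->
  1 / (k`!%:R * 2 `^ (renyi2 q + NB%:R - k%:R * NA%:R)) =
  (\sum_x q x ^+ 2) * (2 ^ NA)%:R ^+ k / (k`!%:R * (2 ^ NB)%:R) :> R.
Proof.
set P := \sum_x _ => P0.
have l2 : 0 < ln 2 :> R by apply: ln_gt0; lra.
have pow n : expR (n%:R * ln 2) = (2 ^ n)%:R :> R.
  by rewrite expRM_natl lnK ?posrE // natrX.
have -> : 2 `^ (renyi2 q + NB%:R - k%:R * NA%:R) =
    P^-1 * (2 ^ NB)%:R / (2 ^ NA)%:R ^+ k :> R.
  rewrite /powR pnatr_eq0 /= /renyi2 -/P !mulrDl mulNr divfK ?gt_eqF //.
  have ek : expR (- (k%:R * NA%:R * ln 2)) = ((2 ^ NA)%:R ^+ k)^-1 :> R.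
    by rewrite expRN -mulrA expRM_natl pow.
  by rewrite !expRD expRN lnK ?posrE // pow mulNr ek.
have a0 : (2 ^ NA)%:R ^+ k != 0 :> R by rewrite expf_neq0 // pnatr_eq0 expn_eq0.
have b0 : (2 ^ NB)%:R != 0 :> R by rewrite pnatr_eq0 expn_eq0.
have f0 : k`!%:R != 0 :> R by rewrite pnatr_eq0 -lt0n fact_gt0.
move: (_ ^+ k) a0 ((2 ^ NB)%:R) b0 (k`!%:R) f0 => a a0 b b0 f f0.
by field; rewrite a0 b0 f0 gt_eqF.
Qed.

Theorem theorem1 (R : realType) (k : nat) (hk : (2 <= k)%N)
    (eps : R) (heps : 0 < eps) :
  exists N0 : nat, forall (NA NB : nat),
    (N0 <= NA)%N -> (N0 <= NB)%N ->
    k%:R < 2 `^ ((NA + NB)%:R / 4) :> R ->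
    forall (mu : probability (borel (unitary_group R (2 ^ NA * 2 ^ NB))) R)
           (nu : probability (borel (pure_state R NA)) R),
    is_haar mu -> is_haar_state nu ->
    forall (X : finType) (q : X -> R)
           (phi : X -> 'cV[R[i]%C]_(2 ^ NA * 2 ^ NB)),
    is_distr q -> orthonormal_kets phi ->
    `| rms_distance q phi k nu mu ^+ 2
       / (1 / (k`!%:R * 2 `^ (renyi2 q + NB%:R - k%:R * NA%:R))) - 1 | < eps.
Proof.
have [c c0 hc] := symmetric_dim_ratio R k.
set K : R := 2 * c + 1 + 2 * k`!%:R + 4 * k.+1%:R * k`!%:R.
have K0 : 0 <= K by rewrite !addr_ge0 ?mulr_ge0.
(* The relative error is at most [K / 2 ^ NA], and [2 ^ NA > NA > K / eps]. [K] is fixed by [k], so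
   the threshold is uniform in the ensemble of initial states. *)
exists (Num.truncn (K / eps)).+1 => NA NB hNA hNB _ mu nu hmu hnu X q phi hq hphi.
have f0 : 0 < k`!%:R :> R by rewrite ltr0n fact_gt0.
have d1 : 1 <= (2 ^ NA)%:R :> R by rewrite ler1n expn_gt0.
have b1 : 1 <= (2 ^ NB)%:R :> R by rewrite ler1n expn_gt0.
have db : (1 < 2 ^ NA * 2 ^ NB)%N.
  rewrite -expnD -{1}(expn0 2) ltn_exp2l //; lia.
have PE := purity_ge hq hphi.
have P0 : 0 < \sum_x q x ^+ 2.
  by apply: lt_le_trans PE; rewrite invr_gt0 ltr0n; lia.
rewrite target_value // rms_distance_sqr.
have /andP[r1 r2] := hc _ (expn_gt0 2 NA : (0 < 2 ^ NA)%N).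
set r := _ / _ in r1 r2.
have dE : 'C(2 ^ NA + k - 1, k)%:R = r * (2 ^ NA)%:R ^+ k / k`!%:R :> R.
  rewrite /r divfK; last by rewrite expf_neq0 // gt_eqF //; lra.
  by rewrite mulrAC divff ?mul1r // gt_eqF.
have := expected_sqr_distance k hnu hmu hq hphi db.
rewrite dE !natrM => hE.
rewrite natrM in PE.
apply: le_lt_trans (ratio_estimate d1 b1 PE c0 hk r1 r2 hE f0) _.
rewrite -/K ltr_pdivrMr; last exact: lt_le_trans ltr01 d1.
rewrite mulrC -ltr_pdivrMr //.
apply: (lt_trans (truncnS_gt (K / eps))); rewrite ltr_nat.
by apply: leq_ltn_trans hNA _; exact: ltn_expl.
Qed.
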